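(* Let $d\mu$ be the spectral measure of the Jacobi matrix with parameters $a_n\equiv 1$ and real $b_n$ ($n\ge 1$) satisfying $b_n\le b_{n+1}<0$ for all $n\ge 1$ and $b_n\to 0$ as $n\to\infty$. Then: (i) $d\mu$ is purely absolutely continuous on $(-2,2)$, and $w=\frac{d\mu}{dx}$ is continuous and nonvanishing on $(-2,2)$. (ii) There are constants $C_1,C_2>0$ (independent of $x$) such that $C_1(x+2)\le w(x)\le C_2(x+2)^{-1}$ for all $x\in(-2,0]$. (iii) Write $w(x)=e^{-2Q(x)}$ on $(0,2)$. There is a constant $C$, depending on $\sup_n|b_n|$ but not on $x$, such that for all $x\in(0,2)$ with $N(x)\ge 1$, $$|Q(x)-g(x)|\le h(x),\qquad g(x)=\sum_{j=1}^{N(x)}\gamma_j(x),$$ where $h(x)$ is given by $$e^{h(x)}=C\,N(x)\,\bigl(b_{N(x)+2}-b_{N(x)+1}\bigr)^{-1}(2-x)^{1/2}$$ (with $h(x)=+\infty$ if $b_{N(x)+2}=b_{N(x)+1}$).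
   Context: For bounded Jacobi parameters $\{a_n,b_n\}_{n\ge1}$ ($a_n>0$, $b_n\in\mathbb{R}$), the spectral measure is the unique compactly supported probability measure $\mu$ on $\mathbb{R}$ whose orthonormal polynomials $p_n$ satisfy $xp_n=a_{n+1}p_{n+1}+b_{n+1}p_n+a_np_{n-1}$, $p_{-1}=0$, $p_0=1$; equivalently, the spectral measure at the first basis vector of the half-line Jacobi matrix with diagonal entries $b_1,b_2,\dots$ and off-diagonal entries $a_1,a_2,\dots$. For $x\in(0,2)$ the integer $N(x)\ge 0$ (turning point) is defined by $x-b_n\ge 2$ if $1\le n\le N(x)$ and $x-b_n<2$ if $n>N(x)$. For $1\le n\le N(x)$, $\gamma_n(x)\ge 0$ is defined by $x-b_n=2\cosh(\gamma_n(x))$. *)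

(* Defs.v *)
From HB Require Import structures.
From mathcomp Require Export all_boot all_order all_algebra.
From mathcomp Require Export all_classical all_reals all_analysis.

Set Implicit Arguments.
Unset Strict Implicit.
Unset Printing Implicit Defensive.

Import Order.TTheory GRing.Theory Num.Theory.
Import numFieldNormedType.Exports.

Local Open Scope classical_set_scope.
Local Open Scope ring_scope.

(* Jacobi parameters a_n, b_n are indexed by n >= 1, as functions on nat whose
   value at 0 is never used. *)
Section Jacobi.
Variable R : realType.
Implicit Types (a b : nat -> R) (p : nat -> {poly R}) (x : R).
Implicit Types mu : probability (measurableTypeR R) R.

Definition orthonormal_polynomials mu p : Prop :=
  (forall n, size (p n) = n.+1 /\ 0 < lead_coef (p n)) /\
  (forall m n,
     (\int[mu]_x ((p m).[x] * (p n).[x])%:E = ((m == n)%:R : R)%:E)%E).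

(* p_{-1} = 0 accounts for the missing last term when n = 0. *)
Definition jacobi_recurrence a b p : Prop :=
  p 0%N = 1 /\
  forall n, 'X * p n = a n.+1 *: p n.+1 + b n.+1 *: p n
                       + (if n is m.+1 then a n *: p m else 0).

Definition compactly_supported mu : Prop :=
  exists2 K : set R, compact K & mu (~` K) = 0%E.

Definition is_spectral_measure a b mu : Prop :=
  compactly_supported mu /\
  exists2 p, orthonormal_polynomials mu p & jacobi_recurrence a b p.

Definition is_density_on mu (D : set R) (w : R -> R) : Prop :=
  (forall x, D x -> 0 <= w x) /\
  (forall A : set (measurableTypeR R), measurable A -> A `<=` D ->
     (mu A = \int[@lebesgue_measure R]_(x in A) (w x)%:E)%E).

Definition is_turning_point b x (N : nat) : Prop :=
  forall n, (1 <= n)%N ->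
    ((n <= N)%N -> 2 <= x - b n) /\ ((N < n)%N -> x - b n < 2).

Definition turning_point b x : nat := get [set N | is_turning_point b x N].

Definition cosh (t : R) : R := (expR t + expR (- t)) / 2.

(* Meaningful only if 2 <= x - b n, in which case such a t exists and is
   unique. *)
Definition gamma b (n : nat) x : R :=
  get [set t | 0 <= t /\ x - b n = 2 * cosh t].

Definition g b x : R := \sum_(1 <= j < (turning_point b x).+1) gamma b j x.

Definition h (C : R) b x : \bar R :=
  let N := turning_point b x in
  if b N.+2 == b N.+1 then +oo%E
  else (ln (C * N%:R * (b N.+2 - b N.+1)^-1 * Num.sqrt (2 - x)))%:E.

(* The exponent Q with w = exp (- 2 Q), at points where w > 0. *)
Definition exponent (w : R -> R) x : R := - ln (w x) / 2.

Definition sup_abs b : R := sup [set `|b n| | n in [set n | (1 <= n)%N]].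

End Jacobi.

(* Main.v *)
(* Let $p_n$ be the orthonormal polynomials and $y_n = x - b_{n+1}$.  The Turan
   determinant $D_n = p_n^2 - p_{n+1} p_{n-1} = p_n^2 - y_n p_n p_{n-1} + p_{n-1}^2$
   satisfies $D_{n+1} = D_n + (b_{n+2} - b_{n+1}) p_n p_{n+1}$, and as $b$ is
   increasing, completing squares shows that $D_n / (2 + y_n)$ increases and
   $D_n / (2 - y_n)$ decreases in $n$.  Hence $D_n$ converges to a positive
   continuous $D$, locally uniformly on $(-2, 2)$, with explicit two-sided bounds
   of $D$ by $D_m$ for every $m$ such that $y_m < 2$.

   Since $b_n \to 0$, the matrix elements of $f(J)$ far from the origin converge
   to those of the free matrix, which gives $\int f D_n d\mu \to \int f \rho\,dx$
   for polynomials $f$, $\rho$ being the semicircle density.  As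
   $\int |D_n| d\mu \le 2$, this extends to continuous $f$ by the Weierstrass
   theorem; taking $f = \varphi / D$ yields $d\mu = (\rho / D) dx$ on $(-2, 2)$.

   The bounds on $w = \rho / D$ follow from those on $D$: near $-2$ with a fixed
   $m$, and for $x > 0$ with $m = N(x) + 1$, where
   $e^{g} \le p_N \le (N + 1) e^{g}$. *)

Require Import Defs.
From HB Require Import structures.
From mathcomp Require Import all_boot all_order all_algebra.
From mathcomp Require Import all_classical all_reals all_analysis.
From mathcomp Require Import measurable_realfun.
From mathcomp Require Import ring lra.

Import Order.TTheory GRing.Theory Num.Theory.
Import numFieldNormedType.Exports.

Local Open Scope classical_set_scope.
Local Open Scope ring_scope.

Set Implicit Arguments.
Unset Strict Implicit.
Unset Printing Implicit Defensive.

(** * Orthonormal polynomials and their Turan determinants *)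

Section turan.
Context {R : realType}.
Implicit Types (b : nat -> R) (x : R).

(* Shifted by one, [jpol b x n.+1] being $p_n(x)$, so that $p_{-1} = 0$ is
   [jpol b x 0]. *)
Fixpoint jpol b x (n : nat) : R :=
  if n is m.+1 then
    if m is k.+1 then (x - b m) * jpol b x m - jpol b x k else 1
  else 0.

Lemma jpolSS b x n :
  jpol b x n.+2 = (x - b n.+1) * jpol b x n.+1 - jpol b x n.
Proof. by []. Qed.

Definition turan b n x : R :=
  jpol b x n.+1 ^+ 2 - (x - b n.+1) * jpol b x n.+1 * jpol b x n
  + jpol b x n ^+ 2.

Lemma turanE b n x :
  turan b n x = jpol b x n.+1 ^+ 2 - jpol b x n.+2 * jpol b x n.
Proof. by rewrite /turan jpolSS; ring. Qed.

(** The defect is the increment of $b$ times $(p_n - p_{n+1})^2$. This is the decrease of $D_n / (2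
    - y_n)$, cross-multiplied so that it holds whatever the signs of the denominators. *)
Lemma turan_le_upstep b n x : b n.+1 <= b n.+2 ->
  turan b n.+1 x * (2 - (x - b n.+1)) <= turan b n x * (2 - (x - b n.+2)).
Proof.
move=> b_le; rewrite -subr_ge0.
suff -> : turan b n x * (2 - (x - b n.+2)) - turan b n.+1 x * (2 - (x - b n.+1))
   = (b n.+2 - b n.+1) * (jpol b x n.+1 - jpol b x n.+2) ^+ 2.
  by rewrite mulr_ge0 ?sqr_ge0 ?subr_ge0.
by rewrite /turan !jpolSS; ring.
Qed.

(** Here the defect carries $(p_n + p_{n+1})^2$, and the quotient that increases is $D_n / (2 +
    y_n)$. *)
Lemma turan_ge_downstep b n x : b n.+1 <= b n.+2 ->
  turan b n x * (2 + (x - b n.+2)) <= turan b n.+1 x * (2 + (x - b n.+1)).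
Proof.
move=> b_le; rewrite -subr_ge0.
suff -> : turan b n.+1 x * (2 + (x - b n.+1)) - turan b n x * (2 + (x - b n.+2))
   = (b n.+2 - b n.+1) * (jpol b x n.+1 + jpol b x n.+2) ^+ 2.
  by rewrite mulr_ge0 ?sqr_ge0 ?subr_ge0.
by rewrite /turan !jpolSS; ring.
Qed.

(** Run backwards, the recurrence would carry two consecutive zeros down to $p_0 = 1$. *)
Lemma jpol_neq0 b x n : (jpol b x n != 0) || (jpol b x n.+1 != 0).
Proof.
elim: n => [|n IH]; first by rewrite /= oner_eq0 orbT.
rewrite -negb_and; apply/negP => /andP[/eqP q1 /eqP q2].
move: IH; rewrite q1 eqxx orbF => /negP; apply.
by move: q2; rewrite jpolSS q1 mulr0 sub0r => /eqP; rewrite oppr_eq0.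
Qed.

(** For $|y| < 2$ the quadratic form $q_1^2 - y q_1 q + q^2$ is positive definite, and [jpol_neq0]
    keeps its argument away from the origin. *)
Lemma turan_gt0 b n x : -2 < x - b n.+1 < 2 -> 0 < turan b n x.
Proof.
move=> y12; have := jpol_neq0 b x n; rewrite /turan; move: y12.
move: (jpol b x n) (jpol b x n.+1) (x - b n.+1) => q q1 y /andP[y1 y2] q0.
have s0 : 0 < q ^+ 2 + q1 ^+ 2.
  case/orP: q0 => q0.
    by rewrite ltr_pwDl ?sqr_ge0// exprn_even_gt0.
  by rewrite ltr_pwDr ?sqr_ge0// exprn_even_gt0.
have -> : q1 ^+ 2 - y * q1 * q + q ^+ 2 =
  ((2 - y) * (q1 + q) ^+ 2 + (2 + y) * (q1 - q) ^+ 2) / 4 by field.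
have y1' : 0 < 2 + y by lra.
have y2' : 0 < 2 - y by lra.
rewrite divr_gt0//; have [a0|a0] := eqVneq (q1 + q) 0.
  rewrite a0 expr0n mulr0 add0r mulr_gt0// exprn_even_gt0//=.
  apply/negP => /eqP c0; have e1 : q1 = 0 by lra.
  have e2 : q = 0 by lra.
  by move: s0; rewrite e1 e2 expr0n/= addr0 ltxx.
apply: ltr_pwDl; first by rewrite mulr_gt0// exprn_even_gt0.
by rewrite mulr_ge0 ?sqr_ge0 ?(ltW y1').
Qed.

Lemma jpol_continuous b n : continuous (fun x => jpol b x n).
Proof.
suff: continuous (fun x => jpol b x n) /\ continuous (fun x => jpol b x n.+1).
  by case.
elim: n => [|n [IH1 IH2]]; first by split=> x; exact: cvg_cst.
split=> // x; rewrite /continuous_at.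
under eq_fun do rewrite jpolSS; rewrite jpolSS.
by apply: cvgB; [apply: cvgM; [apply: cvgB => //; exact: cvg_cst|exact: IH2]
  |exact: IH1].
Qed.

Lemma turan_continuous b n : continuous (turan b n).
Proof.
move=> x; rewrite /continuous_at /turan.
by apply: cvgD; [apply: cvgB|]; rewrite ?expr2;
  repeat (apply: cvgM || exact: jpol_continuous || apply: cvgB || exact: cvg_cst
    || exact: cvg_id).
Qed.

End turan.

Arguments jpol : simpl never.
Arguments turan : simpl never.

(** * Comparison of Turan determinants at two indices *)

Section turan_monotonicity.
Context {R : realType} {b : nat -> R}.
Hypothesis b_nd : forall n, b n.+1 <= b n.+2.
Hypothesis b_lt0 : forall n, b n.+1 < 0.
Hypothesis b_cvg0 : b @ \oo --> (0 : R).
Implicit Types (x : R) (m n : nat).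

Lemma b_le m n : (m <= n)%N -> b m.+1 <= b n.+1.
Proof.
by apply: (@homo_leq _ (fun k => b k.+1) (fun u v : R => u <= v)) => //;
  exact: le_trans.
Qed.

Lemma b_near0 (e : R) : 0 < e -> exists m, forall n, (m <= n)%N -> - e < b n.+1.
Proof.
move=> e0; have /cvgrPdist_lt /(_ e e0) [m _ mP] := b_cvg0.
exists m => n mn; have := mP n.+1 (leqW mn); rewrite sub0r normrN.
by rewrite ltr_norml => /andP[].
Qed.

(** Chains [turan_ge_downstep]; each link multiplies by $2 + y_k$ and cancels it, which is positive
    because $x > -2$ and $b < 0$. *)
Lemma turan_ge m n x : (m <= n)%N -> -2 < x ->
  turan b m x * (2 + (x - b n.+1)) <= turan b n x * (2 + (x - b m.+1)).
Proof.
move=> + x2; have p k : 0 < 2 + (x - b k.+1) by have := b_lt0 k; lra.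
elim: n => [|n IH]; first by rewrite leqn0 => /eqP ->.
rewrite leq_eqVlt => /predU1P[->//|/IH {}IH].
rewrite -(ler_pM2r (p n)) mulrAC.
apply: (@le_trans _ _ (turan b n x * (2 + (x - b m.+1)) * (2 + (x - b n.+2)))).
  by rewrite ler_pM2r// p.
by rewrite mulrAC [leRHS]mulrAC ler_pM2r ?p// turan_ge_downstep.
Qed.

(** Chains [turan_le_upstep]. As $y_k$ does not increase with $k$, the condition $y_m < 2$ persists
    and keeps the factors $2 - y_k$ positive. *)
Lemma turan_le m n x : (m <= n)%N -> x - b m.+1 < 2 ->
  turan b n x * (2 - (x - b m.+1)) <= turan b m x * (2 - (x - b n.+1)).
Proof.
move=> + x2.
have p k : (m <= k)%N -> 0 < 2 - (x - b k.+1) by move=> /b_le; lra.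
elim: n => [|n IH]; first by rewrite leqn0 => /eqP ->.
rewrite leq_eqVlt => /predU1P[->//|]; rewrite ltnS => mn.
rewrite -(ler_pM2r (p n mn)).
apply: (@le_trans _ _ (turan b n x * (2 - (x - b m.+1)) * (2 - (x - b n.+2)))).
  by rewrite mulrAC [leRHS]mulrAC ler_pM2r ?p// turan_le_upstep.
by rewrite [leRHS]mulrAC ler_pM2r ?IH ?p// ltnW.
Qed.

End turan_monotonicity.

(** * The limit $D$ of the Turan determinants *)

Section turan_limit.
Context {R : realType} {b : nat -> R}.
Hypothesis b_nd : forall n, b n.+1 <= b n.+2.
Hypothesis b_lt0 : forall n, b n.+1 < 0.
Hypothesis b_cvg0 : b @ \oo --> (0 : R).
Implicit Types (x : R) (m n : nat).

(** From some index $m$ on, $y_k < 2$, so $D_k / (2 - y_k)$ is nonincreasing and nonnegative, hence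
    convergent; multiplying back by $2 - y_k$, which tends to $2 - x$, recovers $D_k$. *)
Lemma turan_cvg_ex x : -2 < x < 2 -> cvgn (turan b ^~ x).
Proof.
move=> /andP[x1 x2].
have [|m mP] := @b_near0 _ _ b_cvg0 (2 - x); first by lra.
have p k : 0 < 2 - (x - b (m + k).+1) by have := mP (m + k)%N (leq_addr _ _); lra.
have yc : (fun k => 2 - (x - b (k + m.+1)%N)) @ \oo --> 2 - (x - 0).
  apply: cvgB; first exact: cvg_cst.
  apply: cvgB; first exact: cvg_cst.
  by rewrite (cvg_shiftn m.+1).
pose e k := turan b (k + m) x / (2 - (x - b (k + m.+1)%N)).
have ec : cvgn e.
  apply: nonincreasing_is_cvgn; last first.
    exists 0 => _ [k _ <-]; rewrite /e.
    have mk := mP (k + m)%N (leq_addl _ _); have bk := b_lt0 (k + m)%N.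
    by rewrite addnS divr_ge0 ?ltW// ?turan_gt0 //; lra.
  apply/nonincreasing_seqP => k; rewrite /e.
  have mk := mP (k + m)%N (leq_addl _ _).
  have mk1 := mP (k.+1 + m)%N (leq_addl _ _).
  have frac_le (u v y z : R) : 0 < y -> 0 < z -> u * y <= v * z -> u / z <= v / y.
    by move=> y0 z0 uv; rewrite ler_pdivrMr// mulrAC ler_pdivlMr.
  rewrite !addnS addSn; rewrite addSn in mk1.
  by apply: frac_le; [lra|lra|exact: turan_le_upstep].
have : cvgn (fun k => turan b (k + m) x).
  have -> : (fun k => turan b (k + m) x) = (fun k => e k * (2 - (x - b (k + m.+1)%N))).
    apply/funext => k; rewrite /e mulfVK// addnS.
    by have := mP (k + m)%N (leq_addl _ _); lra.
  by apply: is_cvgM => //; apply: cvgP yc.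
move=> /cvg_ex[l]; rewrite (cvg_shiftn m (turan b ^~ x)).
exact: cvgP.
Qed.

Definition turan_lim x : R := lim (turan b ^~ x @ \oo).

Lemma turan_lim_ge m x : -2 < x < 2 ->
  turan b m x * (2 + x) <= turan_lim x * (2 + (x - b m.+1)).
Proof.
move=> x12; have Tc := turan_cvg_ex x12; case/andP: x12 => x1 x2.
apply: (@ler_cvg_to _ \oo _ R
  (fun n => turan b m x * (2 + (x - b n.+1)))
  (fun n => turan b n x * (2 + (x - b m.+1)))).
- apply: cvgMl_tmp; apply: cvgD; first exact: cvg_cst.
  rewrite -[X in _ --> X]subr0; apply: cvgB; first exact: cvg_cst.
  by rewrite (cvg_shiftS b).
- by apply: cvgMr_tmp.
- by exists m => // n /= mn; exact: turan_ge.
Qed.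

Lemma turan_lim_le m x : -2 < x < 2 -> x - b m.+1 < 2 ->
  turan_lim x * (2 - (x - b m.+1)) <= turan b m x * (2 - x).
Proof.
move=> x12 y2; have Tc := turan_cvg_ex x12; case/andP: x12 => x1 x2.
apply: (@ler_cvg_to _ \oo _ R
  (fun n => turan b n x * (2 - (x - b m.+1)))
  (fun n => turan b m x * (2 - (x - b n.+1)))).
- by apply: cvgMr_tmp.
- apply: cvgMl_tmp; apply: cvgB; first exact: cvg_cst.
  rewrite -[X in _ --> X]subr0; apply: cvgB; first exact: cvg_cst.
  by rewrite (cvg_shiftS b).
- by exists m => // n /= mn; exact: turan_le.
Qed.

Lemma turan_lim_gt0 x : -2 < x < 2 -> 0 < turan_lim x.
Proof.
move=> x12; have /andP[x1 x2] := x12.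
have [|m /(_ m (leqnn m)) mP] := @b_near0 _ _ b_cvg0 (2 - x); first by lra.
have bm := b_lt0 m.
have := turan_lim_ge m x12.
rewrite -ler_pdivrMr; last by lra.
apply: lt_le_trans; rewrite divr_gt0 ?mulr_gt0//; [|lra|lra].
by apply: turan_gt0; lra.
Qed.

(** [turan_lim_ge] and [turan_lim_le] confine $D - D_m$ to within $-b_{m+1} D_m$ divided by $2 \pm
    y_m$. Monotonicity from the fixed index [m0] bounds $D_m$ uniformly on $[c, d]$. *)
Lemma turan_lim_unif (c d : R) : -2 < c -> c <= d -> d < 2 ->
  exists K, exists m0, forall m x, (m0 <= m)%N -> x \in `[c, d] ->
    `|turan_lim x - turan b m x| <= K * - b m.+1.
Proof.
move=> c2 cd d2.
have [|m0 m0P] := @b_near0 _ _ b_cvg0 ((2 - d) / 2); first by lra.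
have [z zcd zM] := @EVT_max R (turan b m0) c d cd
  (continuous_subspaceT (@turan_continuous _ b m0)).
have M0 : 0 < turan b m0 z.
  have := m0P m0 (leqnn _); have := b_lt0 m0.
  by move: zcd; rewrite in_itv/= => /andP[z1 z2] ? ?; apply: turan_gt0; lra.
set M := turan b m0 z in zM M0.
(* On $[c, d]$ and for $m \ge m_0$, both $2 - y_m$ and $2 + y_m$ are at least [e]. One division by
   [e] gives $D_m \le 4M/e$, the other one bounds the difference. *)
pose e := Num.min ((2 - d) / 2) (c + 2).
have e0 : 0 < e by rewrite lt_min; apply/andP; split; lra.
have e1 : e <= (2 - d) / 2 by rewrite ge_min lexx.
have e2 : e <= c + 2 by rewrite ge_min lexx orbT.
exists (M * 4 / e / e), m0 => m x mm0 xcd.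
have Tz := zM _ xcd.
move: (xcd); rewrite in_itv/= => /andP[cx xd].
have bm := m0P _ mm0; have bm' := b_lt0 m.
have bm0 := m0P _ (leqnn m0); have bm0' := b_lt0 m0.
have T0 : 0 < turan b m x by apply: turan_gt0; lra.
have TM : turan b m x <= M * 4 / e.
  rewrite ler_pdivlMr//.
  have /(turan_le b_nd) := mm0 => /(_ x) H.
  have {}H : turan b m x * (2 - (x - b m0.+1)) <= turan b m0 x * (2 - (x - b m.+1)).
    by apply: H; lra.
  have H1 : turan b m x * e <= turan b m x * (2 - (x - b m0.+1)).
    by rewrite ler_pM2l//; lra.
  apply: (le_trans H1); apply: (le_trans H).
  apply: ler_pM; rewrite //; [|lra|lra].
  by apply/ltW/turan_gt0; lra.
have L1 : turan b m x * (2 + x) <= turan_lim x * (2 + (x - b m.+1)).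
  by apply: turan_lim_ge; lra.
have L2 : turan_lim x * (2 - (x - b m.+1)) <= turan b m x * (2 - x).
  by apply: turan_lim_le; lra.
have K0 : `|turan_lim x - turan b m x| * e <= turan b m x * - b m.+1.
  case: (leP (turan b m x) (turan_lim x)) => LT.
    have d0 : 0 <= turan_lim x - turan b m x by rewrite subr_ge0.
    rewrite ger0_norm//.
    apply: (@le_trans _ _ ((turan_lim x - turan b m x) * (2 - (x - b m.+1)))).
      by rewrite ler_wpM2l//; lra.
    by rewrite mulrBl; move: L2; rewrite !mulrBr; lra.
  have d0 : 0 <= turan b m x - turan_lim x by rewrite subr_ge0 ltW.
  rewrite distrC ger0_norm//.
  apply: (@le_trans _ _ ((turan b m x - turan_lim x) * (2 + (x - b m.+1)))).
    by rewrite ler_wpM2l//; lra.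
  by rewrite mulrBl; move: L1; rewrite !mulrDr; lra.
rewrite -ler_pdivlMr// in K0; apply: (le_trans K0).
rewrite mulrAC; apply: ler_wpM2r; first by lra.
by rewrite ler_pM2r ?invr_gt0.
Qed.

(** A locally uniform limit of continuous functions; [c] and [d] are the midpoints between $x$ and
    the endpoints of $]-2, 2[$. *)
Lemma turan_lim_continuous x : -2 < x < 2 -> {for x, continuous turan_lim}.
Proof.
move=> /andP[x1 x2].
pose c := (x - 2) / 2; pose d := (x + 2) / 2.
have [|||K [m0 KP]] := @turan_lim_unif c d;
  [rewrite/c; lra|rewrite/c/d; lra|rewrite/d; lra|].
apply/cvgrPdist_le => e e0.
have K1 : 0 < `|K| + 1 by rewrite ltr_pwDr.
have [|m1 m1P] := @b_near0 _ _ b_cvg0 (e / 3 / (`|K| + 1)).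
  by rewrite !divr_gt0.
pose m := maxn m0 m1.
have H z : z \in `[c, d] -> `|turan_lim z - turan b m z| <= e / 3.
  move=> zcd; apply: (le_trans (KP m z (leq_maxl _ _) zcd)).
  have bm := m1P m (leq_maxr _ _).
  have bm' := b_lt0 m.
  apply: (@le_trans _ _ ((`|K| + 1) * - b m.+1)).
    by rewrite ler_wpM2r//; [lra|rewrite (le_trans (ler_norm _))// lerDl].
  by rewrite mulrC -ler_pdivlMr//; lra.
have [xc xd] : c < x /\ x < d by rewrite /c /d; lra.
have Tc := @turan_continuous _ b m x.
move/cvgrPdist_le : Tc => /(_ (e / 3)) => Tc.
have xcd : x \in `[c, d] by rewrite in_itv/= !ltW.
have xN : \forall z \near x, z \in `[c, d].
  near=> z; rewrite in_itv/=; apply/andP; split; apply: ltW.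
    by near: z; exact: lt_nbhsr.
  by near: z; exact: lt_nbhsl.
near=> z.
have zcd : z \in `[c, d] by near: z.
have Tz : `|turan b m x - turan b m z| <= e / 3.
  by near: z; apply: Tc; rewrite divr_gt0.
have := H _ xcd; have := H _ zcd.
move: Tz; rewrite !ler_norml => /andP[? ?] /andP[? ?] /andP[? ?].
by apply/andP; split; lra.
Unshelve. all: by end_near.
Qed.

End turan_limit.

Arguments turan_lim {R} b x.

(** * Growth of $p_n$ up to the turning point *)

Section growth.
Context {R : realType}.

(* Applied to $u_n = e^{-\gamma_n}$ and $q_n = e^{-(\gamma_1 + \dots + \gamma_n)} p_n$;
   the last bound telescopes. *)
Lemma scaled_growth (u q : nat -> R) (N : nat) :
  (forall n, (n < N)%N -> 0 < u n.+1 <= 1) ->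
  (forall n, (n.+1 < N)%N -> u n.+1 <= u n.+2) ->
  q 0 = 1 -> ((0 < N)%N -> q 1 = 1 + u 1 ^+ 2) ->
  (forall n, (n.+1 < N)%N ->
     q n.+2 = (1 + u n.+2 ^+ 2) * q n.+1 - u n.+1 * u n.+2 * q n) ->
  forall n, (n < N)%N ->
    [/\ 1 <= q n, q n <= q n.+1, q n <= n.+1%:R & q n.+1 - u n.+1 * q n <= 1].
Proof.
move=> u01 u_nd q0 q1 qSS; elim=> [|n IH] nN.
  have /andP[u0 u1] := u01 _ nN; rewrite q0 q1// mulr1; split=> //.
    by rewrite lerDl sqr_ge0.
  by rewrite expr2; nra.
have {IH}[IH1 IH2 IH3 IH4] := IH (ltnW nN).
have /andP[u0 u1] := u01 _ (ltnW nN); have /andP[v0 v1] := u01 _ nN.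
have uv := u_nd _ nN; rewrite qSS//.
move: (q n) (q n.+1) (u n.+1) (u n.+2) IH1 IH2 IH3 IH4 u0 u1 v0 v1 uv
  => qn q' u' v h1 h2 h3 h4 u0 u1 v0 v1 uv.
have k0 : 0 <= v * q' - u' * qn.
  by rewrite subr_ge0 ler_pM//; [exact: ltW|lra].
have e : (1 + v ^+ 2) * q' - u' * v * qn = q' + v * (v * q' - u' * qn) by ring.
have k1 : 0 <= v * (v * q' - u' * qn) by rewrite mulr_ge0// ltW.
have k2 : v * (v * q' - u' * qn) <= v * q' - u' * qn by rewrite ler_piMl.
rewrite e -addn1 natrD; split; [lra|lra| |lra].
have : u' * qn <= qn by rewrite ler_piMl//; lra.
lra.
Qed.

Lemma cosh_surj (y : R) : 2 <= y -> exists t : R, 0 <= t /\ y = 2 * cosh t.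
Proof.
move=> y2; pose r := Num.sqrt (y ^+ 2 - 4).
have r2 : r ^+ 2 = y ^+ 2 - 4 by rewrite sqr_sqrtr//; nra.
have r0 : 0 <= r := sqrtr_ge0 _.
(* The larger root of $s + s^{-1} = y$; the smaller one is its inverse. *)
pose s := (y + r) / 2.
have s1 : 1 <= s by rewrite /s; lra.
exists (ln s); split; first exact: ln_ge0.
have s0 : 0 < s by lra.
rewrite /cosh expRN lnK ?posrE//.
have -> : s^-1 = (y - r) / 2.
  apply: (mulfI (lt0r_neq0 s0)); rewrite divff ?lt0r_neq0// /s.
  have -> : (y + r) / 2 * ((y - r) / 2) = (y ^+ 2 - r ^+ 2) / 4 by field.
  by rewrite r2; field.
by rewrite /s; field.
Qed.

Lemma gammaP (b : nat -> R) n (x : R) : 2 <= x - b n ->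
  0 <= Defs.gamma b n x /\ x - b n = 2 * cosh (Defs.gamma b n x).
Proof.
move=> /cosh_surj tP.
exact: (@getPex _ [set t : R | 0 <= t /\ x - b n = 2 * cosh t]).
Qed.

Lemma cosh_le (s t : R) : 0 <= s -> 0 <= t -> cosh s <= cosh t -> s <= t.
Proof.
move=> s0 t0; apply: contraTT; rewrite -!ltNge /cosh => ts.
rewrite ltr_pM2r// !expRN.
have e1 : 1 <= expR t by rewrite -expR0 ler_expR.
have e2 : expR t < expR s by rewrite ltr_expR.
move: (expR t) (expR s) e1 e2 => p q e1 e2.
rewrite -subr_gt0.
have -> : q + q^-1 - (p + p^-1) = (q - p) * (1 - (p * q)^-1).
  by field; apply/andP; split; lra.
rewrite mulr_gt0 ?subr_gt0// invf_lt1; nra.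
Qed.

Section turning.
Variable b : nat -> R.
Hypothesis b_nd : forall n, b n.+1 <= b n.+2.
Hypothesis b_lt0 : forall n, b n.+1 < 0.
Hypothesis b_cvg0 : b @ \oo --> (0 : R).

Lemma turning_pointP x : x < 2 -> is_turning_point b x (turning_point b x).
Proof.
move=> x2; apply: (@getPex _ [set N | is_turning_point b x N]).
have exN : exists n, x - b n.+1 < 2.
  have [|m mP] := @b_near0 _ _ b_cvg0 (2 - x); first by lra.
  by exists m; have := mP _ (leqnn m); lra.
(* The first index that fails is [N.+1], so the turning point is [N], possibly 0. *)
case: (ex_minnP exN) => N N2 Nmin; exists N => -[//|n] _; split=> nN.
  by rewrite leNgt; apply/negP => /Nmin; rewrite leqNgt nN.
by apply: le_lt_trans N2; rewrite lerD2l lerN2; exact: b_le.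
Qed.

(** Dividing $p_n$ by $e^{\gamma_1 + \dots + \gamma_n}$ and writing $x - b_n = u_n + u_n^{-1}$ with
    $u_n = e^{-\gamma_n}$ puts the recurrence in the form of [scaled_growth]. *)
Lemma jpol_growth x N : is_turning_point b x N -> (0 < N)%N ->
  let G := expR (\sum_(1 <= j < N.+1) Defs.gamma b j x) in
  [/\ 0 <= jpol b x N, jpol b x N <= jpol b x N.+1, G <= jpol b x N.+1 &
      jpol b x N.+1 <= N.+1%:R * G].
Proof.
move=> tN N0 G.
have gP n : (n < N)%N -> 0 <= Defs.gamma b n.+1 x /\
    x - b n.+1 = expR (Defs.gamma b n.+1 x) + expR (- Defs.gamma b n.+1 x).
  move=> nN; have [|g0 ge] := @gammaP b n.+1 x.
    by have [H _] := tN n.+1 isT; exact: H.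
  by split=> //; rewrite ge /cosh mulrC divfK.
pose u n := expR (- Defs.gamma b n x).
pose W n := expR (- \sum_(1 <= j < n.+1) Defs.gamma b j x).
have W0 n : 0 < W n := expR_gt0 _.
have WS n : W n.+1 = W n * u n.+1.
  by rewrite /W big_nat_recr//= opprD expRD.
have u0 n : 0 < u n := expR_gt0 _.
have yE n : (n < N)%N -> x - b n.+1 = u n.+1 + (u n.+1)^-1.
  by move=> /gP[_ ->]; rewrite /u -expRN opprK addrC.
pose q n := jpol b x n.+1 * W n.
have H : forall n, (n < N)%N ->
    [/\ 1 <= q n, q n <= q n.+1, q n <= n.+1%:R & q n.+1 - u n.+1 * q n <= 1].
  apply: scaled_growth.
  - by move=> n nN; rewrite u0/= /u -expR0 ler_expR oppr_le0; case: (gP _ nN).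
  - move=> n nN; rewrite /u ler_expR lerN2.
    have [g0 _] := gP _ (ltnW nN); have [g1 _] := gP _ nN.
    apply: cosh_le => //.
    have [|_ e0] := @gammaP b n.+1 x.
      by have [K _] := tN n.+1 isT; apply: K; exact: ltnW.
    have [|_ e1] := @gammaP b n.+2 x.
      by have [K _] := tN n.+2 isT; apply: K.
    by have := b_nd n; lra.
  - by rewrite /q /W big_geq// oppr0 expR0 mulr1.
  - move=> _; rewrite /q WS /W big_geq// oppr0 expR0 mul1r jpolSS /jpol.
    rewrite (yE 0)//; field; exact: lt0r_neq0.
  - move=> n nN; rewrite /q !WS [jpol b x n.+3]jpolSS (yE n.+1)//.
    by field; exact: lt0r_neq0.
have NN : (N.-1 < N)%N by rewrite prednK.
have [h1 h2 h3 h4] := H _ NN; rewrite prednK// in h2 h3 h4.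
have u1 : u N <= 1.
  by rewrite /u -expR0 ler_expR oppr_le0 -(prednK N0); case: (gP _ NN).
have GW : G * W N = 1 by rewrite /G /W -expRD subrr expR0.
have GE : G = (W N)^-1 by rewrite -[G](mulfK (lt0r_neq0 (W0 N))) GW mul1r.
have qE : jpol b x N.+1 = q N * G by rewrite GE /q mulfK// lt0r_neq0.
have G0 : 0 < G := expR_gt0 _.
have jN : jpol b x N = q N.-1 / W N.-1.
  by rewrite /q prednK// mulfK// lt0r_neq0.
have p0 : 0 <= jpol b x N by rewrite jN divr_ge0 ?(ltW (W0 _))//; lra.
split=> //.
(* This is $q_{N-1} \le q_N$ with the scaling undone: [W N.-1] and [W N] differ by the factor
   [u N]. *)
- have : jpol b x N <= u N * jpol b x N.+1.
    rewrite jN ler_pdivrMr//; apply: (le_trans h2); rewrite /q.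
    have -> : W N = W N.-1 * u N by rewrite -[in LHS](prednK N0) WS prednK.
    by rewrite le_eqVlt; apply/orP; left; apply/eqP; ring.
  move=> /le_trans; apply; rewrite ler_piMl//.
  by rewrite qE mulr_ge0 ?(ltW G0)//; lra.
- by rewrite qE ler_peMl ?(ltW G0)//; lra.
(* Here $q_N \le 1 + u_N q_{N-1} \le 1 + N$. *)
- rewrite qE ler_pM2r// -addn1 natrD.
  have : u N * q N.-1 <= q N.-1 by rewrite ler_piMl//; lra.
  lra.
Qed.

End turning.
End growth.

(** * The density $\rho / D$ and its bounds on $]0, 2[$ *)

Definition semicircle {R : realType} (x : R) : R :=
  Num.sqrt (4 - x ^+ 2) / (2 * pi).

Definition weight {R : realType} (b : nat -> R) (x : R) : R :=
  semicircle x / turan_lim b x.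

Section edge_bounds.
Context {R : realType} {b : nat -> R}.
Hypothesis b_nd : forall n, b n.+1 <= b n.+2.
Hypothesis b_lt0 : forall n, b n.+1 < 0.
Hypothesis b_cvg0 : b @ \oo --> (0 : R).

Lemma semicircle_gt0 (x : R) : -2 < x < 2 -> 0 < semicircle x.
Proof.
move=> /andP[x1 x2]; rewrite divr_gt0 ?mulr_gt0 ?pi_gt0// sqrtr_gt0; nra.
Qed.

Lemma weight_gt0 (x : R) : -2 < x < 2 -> 0 < weight b x.
Proof. by move=> x12; rewrite divr_gt0 ?semicircle_gt0 ?turan_lim_gt0. Qed.

(** Since $x - b_{N+1} < 2$, the increment $b_{N+2} - b_{N+1}$ is a lower bound for $2 - (x -
    b_{N+2})$. This margin controls both the positive definiteness of $D_{N+1}$ and the loss in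
    passing from $D_{N+1}$ to $D$, while $p_N$ is within a factor $N + 1$ of [G]. *)
Lemma turan_lim_edge (x : R) : 0 < x < 2 -> (0 < turning_point b x)%N ->
  let N := turning_point b x in let G := expR (g b x) in
  b N.+1 < b N.+2 ->
  (b N.+2 - b N.+1) / 4 * G ^+ 2 <= turan_lim b x /\
  turan_lim b x <=
    8 * N.+1%:R ^+ 2 * G ^+ 2 * (2 - x) / (b N.+2 - b N.+1).
Proof.
move=> /andP[x0 x2] N0 N G bb.
have tN := turning_pointP b_nd b_cvg0 x2.
have [] := jpol_growth b_nd tN N0; rewrite -/N -/(g b x) -/G => h1 h2 h3 h4.
have y2 : x - b N.+1 < 2 by have [_ H] := tN N.+1 isT; exact: H.
have bN1 := b_lt0 N; have bN2 := b_lt0 N.+1.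
have x12 : -2 < x < 2 by apply/andP; split; lra.
have L1 := turan_lim_ge b_nd b_lt0 b_cvg0 N.+1 x12.
have L2 : turan_lim b x * (2 - (x - b N.+2)) <= turan b N.+1 x * (2 - x).
  by apply: turan_lim_le => //; lra.
have L0 := turan_lim_gt0 b_nd b_lt0 b_cvg0 x12.
have G0 : 0 < G := expR_gt0 _.
move: L1 L2 L0; rewrite /turan jpolSS.
move: (turan_lim b x) => L.
move: (jpol b x N) (jpol b x N.+1) h1 h2 h3 h4 => p' p h1 h2 h3 h4.
set M : R := N.+1%:R in h4 *.
move: (b N.+1) (b N.+2) bb y2 bN1 bN2 => c d bb y2 bN1 bN2.
set r := (x - c) * p - p' => L1 L2 L0.
(* [p'], [p] and [r] are $p_{N-1}$, $p_N$ and $p_{N+1}$; the two bounds on [r] use $0 < x - c < 2$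
   and $0 \le p' \le p$. *)
have r1 : r <= 2 * p by rewrite /r; nra.
have r2 : - p <= r by rewrite /r; nra.
set T := r ^+ 2 - (x - d) * r * p + p ^+ 2 in L1 L2.
have pG2 : G ^+ 2 <= p ^+ 2 by rewrite ler_sqr ?nnegrE//; lra.
have pM2 : p ^+ 2 <= M ^+ 2 * G ^+ 2.
  by rewrite -exprMn ler_sqr ?nnegrE ?mulr_ge0//; lra.
split.
  (* Completing the square in [r] leaves $(1 - (x - d)^2 / 4) p^2$, whose factor $(2 - (x - d)) / 2$
     is at least $(d - c) / 2$, the other one being at least 1. *)
  have T1 : (d - c) / 2 * p ^+ 2 <= T.
    rewrite /T -subr_ge0.
    have -> : r ^+ 2 - (x - d) * r * p + p ^+ 2 - (d - c) / 2 * p ^+ 2 =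
      (r - (x - d) / 2 * p) ^+ 2 +
      (((2 - (x - d)) / 2) * ((2 + (x - d)) / 2) - (d - c) / 2) * p ^+ 2 by field.
    rewrite addr_ge0 ?sqr_ge0// mulr_ge0 ?sqr_ge0//; nra.
  have T0 : 0 <= T by apply: le_trans T1; rewrite mulr_ge0 ?sqr_ge0//; lra.
  have : T * 2 <= L * 4.
    apply: (@le_trans _ _ (T * (2 + x))); first by rewrite ler_wpM2l//; lra.
    by apply: (le_trans L1); rewrite ler_wpM2l//; lra.
  have : (d - c) / 2 * G ^+ 2 <= (d - c) / 2 * p ^+ 2 by rewrite ler_wpM2l//; lra.
  by move: (G ^+ 2) (p ^+ 2) T1 => X Y; nra.
have T2 : T <= 8 * p ^+ 2.
  have k1 : 0 <= (2 * p - r) * (2 * p + r) by rewrite mulr_ge0//; lra.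
  have k2 : 0 <= (x - d) * (p + r) * p by rewrite !mulr_ge0//; lra.
  have k3 : 0 <= (2 - (x - d)) * p ^+ 2 by rewrite mulr_ge0 ?sqr_ge0//; lra.
  rewrite -subr_ge0; apply: le_trans (addr_ge0 (addr_ge0 k1 k2)
    (addr_ge0 k3 (sqr_ge0 p))) _; rewrite le_eqVlt; apply/orP; left.
  by rewrite /T; apply/eqP; ring.
rewrite ler_pdivlMr ?subr_gt0//.
apply: (@le_trans _ _ (L * (2 - (x - d)))); first by rewrite ler_pM2l//; lra.
apply: (le_trans L2); rewrite ler_pM2r; last by lra.
by move: (G ^+ 2) (p ^+ 2) (M ^+ 2) T2 pM2 => X Y Z; nra.
Qed.

(** In $w = t / (2 \pi D)$ the root $t = \sqrt{4 - x^2}$ lies between $s$ and $2s$, where $s =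
    \sqrt{2 - x}$. The bounds on $D$ thus become bounds on $w e^{2g}$, whose logarithm is $-2 (Q -
    g)$. *)
Lemma exponent_bound (x : R) : 0 < x < 2 -> (1 <= turning_point b x)%N ->
  ((`|exponent (weight b) x - g b x|)%:E <= h 32 b x)%E.
Proof.
move=> x02 N0; rewrite /h; case: ifPn => [_|bb]; first exact: leey.
have {}bb : b (turning_point b x).+1 < b (turning_point b x).+2.
  by rewrite lt_neqAle eq_sym bb b_nd.
have [L1 L2] := turan_lim_edge x02 N0 bb.
have /andP[x0 x2] := x02.
have x12 : -2 < x < 2 by apply/andP; split; lra.
have L0 := turan_lim_gt0 b_nd b_lt0 b_cvg0 x12.
have w0 := weight_gt0 x12.
set N := turning_point b x in N0 bb L1 L2 *.
set dl := b N.+2 - b N.+1 in L1 L2 *.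
have d0 : 0 < dl by rewrite subr_gt0.
have [_ y2] := turning_pointP b_nd b_cvg0 x2 (isT : (0 < N.+1)%N).
have {}y2 : x - b N.+1 < 2 by exact: y2.
have bN2 := b_lt0 N.+1.
have dx : dl <= 2 - x by rewrite /dl; lra.
pose s := Num.sqrt (2 - x).
have s2 : s ^+ 2 = 2 - x by rewrite sqr_sqrtr//; lra.
have s0 : 0 < s by rewrite sqrtr_gt0; lra.
have sle : s <= 2 by nra.
pose t := Num.sqrt (4 - x ^+ 2).
have t2 : t ^+ 2 = 4 - x ^+ 2 by rewrite sqr_sqrtr//; nra.
have t0 : 0 < t by rewrite sqrtr_gt0; nra.
have ts : s <= t by rewrite ler_sqrt; nra.
have t2s : t <= 2 * s.
  by rewrite -ler_sqr ?nnegrE ?mulr_ge0 ?(ltW t0) ?(ltW s0)// exprMn t2 s2; nra.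
set K : R := N%:R.
have K1 : 1 <= K by rewrite ler1n.
have NK : N.+1%:R = K + 1 :> R by rewrite -addn1 natrD.
rewrite NK in L2; rewrite -/s.
(* This is $e^h$ with $C = 32$. The more demanding estimate below asks for $512 N^2$ in front of
   $s^2$, where $E^2 dl^2$ offers $32^2 N^2$. *)
set E := 32 * K * dl^-1 * s.
have E0 : 0 < E by rewrite !mulr_gt0 ?invr_gt0//; lra.
have Edl : E * dl = 32 * K * s by rewrite /E; field; exact: lt0r_neq0.
have pi2 := @pi_ge2 R; have pi4 : pi <= 4 :> R by have := @pihalf_lt2 R; lra.
have wE : weight b x * (2 * pi * turan_lim b x) = t.
  rewrite /weight /semicircle -/t; field.
  by rewrite !lt0r_neq0//; lra.
set G := expR (g b x) in L1 L2.
have G0 : 0 < G := expR_gt0 _.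
set w := weight b x in w0 wE *; set L := turan_lim b x in L0 L1 L2 wE.
have lnG : ln (G ^+ 2) = 2 * g b x by rewrite lnXn// expRK mulr_natl.
have G20 : 0 < G ^+ 2 by rewrite exprn_gt0.
(* So $s / dl \ge 1/2$: the power of this ratio may be raised at the cost of a factor 2, which
   brings both estimates to the common form $E^2$. *)
have ds : dl <= 2 * s by nra.
(* [w G^2 <= E^2] and [1 <= w G^2 E^2] bound the logarithm of [w] both ways. *)
have wG : w * G ^+ 2 <= E ^+ 2.
  have k1 : w * G ^+ 2 * dl * (pi / 2) <= t.
    rewrite -wE [leLHS](_ : _ = w * (2 * pi * (dl / 4 * G ^+ 2))); last by field.
    by rewrite ler_pM2l// ler_pM2l// mulr_gt0//; lra.
  have k2 : w * G ^+ 2 * dl <= 2 * s.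
    apply: le_trans t2s; apply: le_trans k1.
    have pi1 : 1 <= pi / 2 :> R by lra.
    by rewrite ler_peMr//; exact/ltW/(mulr_gt0 (mulr_gt0 w0 G20) d0).
  rewrite -(ler_pM2r (exprn_gt0 2 d0)) -exprMn Edl !exprMn.
  apply: (@le_trans _ _ (2 * s * dl)); first by rewrite [dl ^+ 2]expr2 mulrA ler_pM2r.
  apply: (@le_trans _ _ (4 * s ^+ 2)); first by clear -s0 d0 ds; nra.
  by rewrite ler_pM2r ?exprn_gt0//; clear -K1; nra.
have wG' : 1 <= w * G ^+ 2 * E ^+ 2.
  have k1 : s * dl <= w * G ^+ 2 * (256 * K ^+ 2) * s ^+ 2.
    apply: (@le_trans _ _ (t * dl)); first by rewrite ler_pM2r.
    move: L2; rewrite ler_pdivlMr// -s2 -wE => L2.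
    apply: (@le_trans _ _
      (w * (2 * pi) * (8 * (K + 1) ^+ 2 * G ^+ 2 * s ^+ 2))).
      have wpi : 0 < w * (2 * pi) by rewrite mulr_gt0// mulr_gt0// pi_gt0.
      by rewrite [leLHS](_ : _ = w * (2 * pi) * (L * dl)) ?ler_pM2l//; ring.
    rewrite -subr_ge0 [leRHS](_ : _ = w * G ^+ 2 * s ^+ 2 *
      (256 * K ^+ 2 - 16 * pi * (K + 1) ^+ 2)); last by ring.
    apply: mulr_ge0; first exact: (mulr_ge0 (mulr_ge0 (ltW w0) (sqr_ge0 G)) (sqr_ge0 s)).
    rewrite subr_ge0.
    apply: (@le_trans _ _ (64 * (K + 1) ^+ 2)).
      by rewrite ler_wpM2r ?sqr_ge0//; lra.
    by clear -K1; nra.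
  rewrite -(ler_pM2r (exprn_gt0 2 d0)) mul1r.
  rewrite [leRHS](_ : _ = w * G ^+ 2 * (E * dl) ^+ 2); last by ring.
  rewrite Edl.
  apply: (@le_trans _ _ (2 * s * dl)); first by clear -s0 d0 ds; nra.
  apply: (@le_trans _ _ (2 * (w * G ^+ 2 * (256 * K ^+ 2) * s ^+ 2))).
    by rewrite -mulrA ler_pM2l.
  rewrite -subr_ge0 [leRHS](_ : _ = w * G ^+ 2 * K ^+ 2 * s ^+ 2 * 512).
    apply: mulr_ge0; last exact: ler0n.
    apply: mulr_ge0; last exact: sqr_ge0.
    exact: (mulr_ge0 (mulr_ge0 (ltW w0) (sqr_ge0 G)) (sqr_ge0 K)).
  by ring.
rewrite lee_fin /exponent ler_norml.
have lnwG : ln (w * G ^+ 2) = ln w + 2 * g b x by rewrite lnM ?posrE// lnG.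
have lnE : ln (E ^+ 2) = 2 * ln E by rewrite lnXn// mulr_natl.
have wG0 : 0 < w * G ^+ 2 := mulr_gt0 w0 G20.
have E20 : 0 < E ^+ 2 := exprn_gt0 2 E0.
have := wG; rewrite -ler_ln ?posrE// lnwG lnE => H1.
have := ln_ge0 wG'; rewrite lnM ?posrE// lnwG lnE => H2.
by rewrite -/w; apply/andP; split; lra.
Qed.

End edge_bounds.

(** * Bounds near the edge $-2$ *)

Section left_edge.
Context {R : realType} {b : nat -> R}.
Hypothesis b_nd : forall n, b n.+1 <= b n.+2.
Hypothesis b_lt0 : forall n, b n.+1 < 0.
Hypothesis b_cvg0 : b @ \oo --> (0 : R).

(** Once $b_{n_0+1} > -1$, the function $D_{n_0}$ is continuous and positive on all of $[-2, 0]$,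
    the endpoint included since $-2 - b_{n_0+1} > -2$. *)
Lemma weight_left_edge : exists C1 C2 : R, [/\ 0 < C1, 0 < C2 &
  forall x, -2 < x <= 0 -> C1 * (x + 2) <= weight b x <= C2 * (x + 2)^-1].
Proof.
have [//|n0 /(_ n0 (leqnn n0)) bn0] := @b_near0 _ _ b_cvg0 1.
have bn0' := b_lt0 n0.
have m20 : -2 <= 0 :> R by lra.
have Tc := continuous_subspaceT (@turan_continuous _ b n0).
have [z zI zM] := @EVT_max R (turan b n0) (-2) 0 m20 (Tc _).
have [u uI um] := @EVT_min R (turan b n0) (-2) 0 m20 (Tc _).
have T0 x : x \in `[-2, 0] -> 0 < turan b n0 x.
  by rewrite in_itv/= => /andP[x1 x2]; apply: turan_gt0; lra.
have {}zI := T0 _ zI; have {}uI := T0 _ uI.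
move: (turan b n0 z) (turan b n0 u) zI uI zM um => M m M0 m0 zM um.
have pi0 := @pi_gt0 R.
(* These combine $D \le 4M$ and $m (2 + x) \le 3D$ with $x + 2 \le \sqrt{4 - x^2} \le 2$. *)
exists (8 * pi * M)^-1, (3 / (pi * m)); split.
- by rewrite invr_gt0 mulr_gt0// mulr_gt0.
- by rewrite divr_gt0// mulr_gt0.
move=> x /andP[x1 x2].
have xI : x \in `[-2, 0] by rewrite in_itv/= (ltW x1).
have x12 : -2 < x < 2 by apply/andP; split; lra.
have L0 := turan_lim_gt0 b_nd b_lt0 b_cvg0 x12.
have L1 := turan_lim_ge b_nd b_lt0 b_cvg0 n0 x12.
have L2 : turan_lim b x * (2 - (x - b n0.+1)) <= turan b n0 x * (2 - x).
  by apply: turan_lim_le => //; lra.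
have TM := zM _ xI; have mT := um _ xI; have {}T0 := T0 _ xI.
rewrite /weight /semicircle.
move: (turan_lim b x) (turan b n0 x) (b n0.+1) L0 L1 L2 TM mT T0 bn0 bn0'
  => L T c L0 L1 L2 TM mT T0 c1 c0.
have LM : L <= 4 * M.
  apply: (@le_trans _ _ (L * (2 - (x - c)))); first by rewrite ler_peMr//; lra.
  apply: (le_trans L2); rewrite mulrC; apply: ler_pM; lra.
have Lm : m * (2 + x) <= L * 3.
  apply: (@le_trans _ _ (T * (2 + x))); first by rewrite ler_wpM2r//; lra.
  by apply: (le_trans L1); rewrite ler_pM2l//; lra.
set t := Num.sqrt _.
have t2 : t ^+ 2 = 4 - x ^+ 2 by rewrite sqr_sqrtr//; nra.
have t0 : 0 <= t := sqrtr_ge0 _.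
have tle : t <= 2 by rewrite -ler_sqr ?nnegrE// t2; nra.
have tge : x + 2 <= t by rewrite -ler_sqr ?nnegrE//; [rewrite t2; nra|lra].
have piL0 : 0 < 2 * pi * L by rewrite mulr_gt0// mulr_gt0.
have -> : t / (2 * pi) / L = t / (2 * pi * L) by rewrite -mulrA -invfM.
apply/andP; split.
  rewrite mulrC; apply: ler_pM => //; first by lra.
    by rewrite invr_ge0 ltW// mulr_gt0// mulr_gt0.
  rewrite lef_pV2 ?posrE ?mulr_gt0//.
  have : 2 * pi * L <= 2 * pi * (4 * M) by rewrite ler_pM2l// mulr_gt0.
  by move=> /le_trans; apply; rewrite le_eqVlt; apply/orP; left; apply/eqP; ring.
rewrite ler_pdivrMr//.
have -> : 3 / (pi * m) * (x + 2)^-1 * (2 * pi * L) = (6 * L) / (m * (2 + x)).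
  by field; repeat (apply/andP; split); apply: lt0r_neq0; lra.
rewrite ler_pdivlMr; last by rewrite mulr_gt0//; lra.
apply: (@le_trans _ _ (2 * (m * (2 + x)))); last by lra.
by rewrite ler_wpM2r// mulr_ge0//; lra.
Qed.

End left_edge.

(** * Weierstrass approximation by Bernstein polynomials *)

Section weierstrass.
Context {R : realType}.
Implicit Types (phi psi : nat -> R) (x : R).

(* The Bernstein operator: the mean of [phi] under the binomial distribution
   with parameters [n] and ['X], computed by conditioning on the first trial. *)
Fixpoint bernstein (n : nat) phi : {poly R} :=
  if n is m.+1 then 'X * bernstein m (phi \o S) + (1 - 'X) * bernstein m phi
  else (phi 0)%:P.

Lemma bernsteinS n phi x : (bernstein n.+1 phi).[x] =
  x * (bernstein n (phi \o S)).[x] + (1 - x) * (bernstein n phi).[x].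
Proof. by rewrite /= !hornerE. Qed.

Lemma bernstein_le n phi psi x : 0 <= x <= 1 ->
  (forall k, (k <= n)%N -> phi k <= psi k) ->
  (bernstein n phi).[x] <= (bernstein n psi).[x].
Proof.
move=> /andP[x0 x1]; elim: n phi psi => [|n IH] phi psi H.
  by rewrite /= !hornerC H.
rewrite !bernsteinS lerD// ler_wpM2l//; [|lra|].
- by apply: IH => k kn /=; exact: H.
- by apply: IH => k kn; apply: H; exact: leqW.
Qed.

Lemma bernsteinD n phi psi x :
  (bernstein n (phi \+ psi)).[x] = (bernstein n phi).[x] + (bernstein n psi).[x].
Proof.
elim: n phi psi => [|n IH] phi psi; first by rewrite /= !hornerC.
by rewrite !bernsteinS !IH; ring.
Qed.

Lemma bernsteinZ n (a : R) phi x :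
  (bernstein n (fun k => a * phi k)).[x] = a * (bernstein n phi).[x].
Proof.
elim: n phi => [|n IH] phi; first by rewrite /= !hornerC.
by rewrite !bernsteinS !IH; ring.
Qed.

Lemma bernstein_cst n (a : R) x : (bernstein n (fun=> a)).[x] = a.
Proof.
elim: n => [|n IH]; first by rewrite /= hornerC.
by rewrite bernsteinS /comp IH; ring.
Qed.

(** Variance plus squared bias. The centre $a$ is arbitrary because conditioning on the first trial
    replaces it by $a - 1$. *)
Lemma bernstein_sqr n (a : R) x :
  (bernstein n (fun k => (k%:R - a) ^+ 2)).[x] =
  n%:R * x * (1 - x) + (n%:R * x - a) ^+ 2.
Proof.
elim: n a => [|n IH] a; first by rewrite /= hornerC; ring.
rewrite bernsteinS IH /comp.
have -> : (fun k => (k.+1%:R - a) ^+ 2) = (fun k : nat => (k%:R - (a - 1)) ^+ 2).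
  by apply/funext => k; rewrite -natr1; ring.
by rewrite IH -natr1; ring.
Qed.

(* Uniform continuity in the form that the variance [bernstein_sqr] can absorb. *)
Lemma uniform_quadratic_bound (f : R -> R) (e : R) : continuous f -> 0 < e ->
  exists2 K : R, 0 <= K & forall x y, x \in `[0, 1] -> y \in `[0, 1] ->
    `|f x - f y| <= e + K * (x - y) ^+ 2.
Proof.
move=> cf e0.
have cI : {within `[0 : R, 1], continuous f} := continuous_subspaceT cf.
have cnI : {within `[0 : R, 1], continuous (fun x => `|f x|)}.
  by apply: continuous_subspaceT => x; apply: cvg_norm; exact: cf.
have [z _ zM] := @EVT_max R (fun x => `|f x|) 0 1 ler01 cnI.
move: (`|f z|) zM => M zM.
have : \forall K \near +oo, `[0 : R, 1] `<=` [set x | forall y, y \in `[0, 1] ->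
    `|f x - f y| <= e + K * (x - y) ^+ 2].
  (* Compactness reduces the choice of a uniform [K] to a neighbourhood of a single point [x0]. *)
  have /compact_near_coveringP/near_covering_withinP := @segment_compact R 0 1.
  apply => x0 _ /=.
  have e20 : 0 < e / 2 by rewrite divr_gt0.
  have /cvgrPdist_lt /(_ _ e20) /nbhs_ballP[d /= d0 dP] := cf x0.
  have d20 : 0 < d / 2 by rewrite divr_gt0.
  (* If [y] is within $d$ of [x0], continuity alone gives [e]; otherwise $|x - y| \ge d/2$, and such
     a [K] makes the quadratic term exceed $2M$. *)
  exists (ball x0 (d / 2), [set K | 2 * M / (d / 2) ^+ 2 < K]).
    split; first exact: nbhsx_ballx.
    by apply: nbhs_pinfty_gt; exact: num_real.
  move=> [x K] /= [xd MK] xI y yI.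
  have Mx : `|f x| <= M by exact: zM.
  have My : `|f y| <= M by exact: zM.
  have M0 : 0 <= M := le_trans (normr_ge0 _) Mx.
  have K0 : 0 <= K.
    apply: le_trans (ltW MK); apply: divr_ge0; last exact: sqr_ge0.
    by rewrite mulr_ge0.
  rewrite /ball/= in xd.
  have [yd|yd] := ltP `|x0 - y| d.
    have h1 : `|f x0 - f y| < e / 2 by apply: dP.
    have h2 : `|f x0 - f x| < e / 2 by apply: dP; apply: lt_trans xd _; lra.
    have h3 : `|f x - f y| <= e.
      move: h1 h2; rewrite ler_norml !ltr_norml => /andP[? ?] /andP[? ?].
      by apply/andP; split; lra.
    by apply: (le_trans h3); rewrite lerDl mulr_ge0 ?sqr_ge0.
  have h : d / 2 <= `|x - y|.
    have := ler_distD x x0 y; lra.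
  have h2 : `|f x - f y| <= 2 * M.
    by apply: (le_trans (ler_normB _ _)); lra.
  apply: (le_trans h2); apply: ler_wpDl; first exact: ltW.
  move: MK; rewrite ltr_pdivrMr ?exprn_gt0// => /ltW/le_trans; apply.
  by rewrite ler_wpM2l// -[leRHS]real_normK ?num_real// ler_sqr ?nnegrE// ltW.
move=> H; near +oo_R => K.
have K0 : 0 <= K by near: K; apply: nbhs_pinfty_ge; exact: num_real.
exists K => // x y xI; have /= := near H K; apply => //.
Unshelve. all: by end_near.
Qed.

(** Averaging the quadratic bound over the binomial distribution leaves $e/2 + K x (1 - x) / n$, so
    $n > K/e$ suffices. *)
Lemma bernstein_approx (f : R -> R) (e : R) : continuous f -> 0 < e ->
  exists p : {poly R}, forall x, x \in `[0, 1] -> `|f x - p.[x]| <= e.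
Proof.
move=> cf e0; have e20 : 0 < e / 2 by rewrite divr_gt0.
have [K K0 KP] := uniform_quadratic_bound cf e20.
pose n := (Num.truncn (K / e)).+1.
have nK : K / e < n%:R.
  by rewrite /n; apply: truncnS_gt.
have n0 : (0 : R) < n%:R by rewrite ltr0n.
exists (bernstein n (fun k => f (k%:R / n%:R))) => x xI.
have /andP[x0 x1] : 0 <= x <= 1 by move: xI; rewrite in_itv.
have bd k : (k <= n)%N -> `|f x - f (k%:R / n%:R)| <=
    e / 2 + K / n%:R ^+ 2 * (k%:R - n%:R * x) ^+ 2.
  move=> kn; apply: le_trans (KP _ _ xI _) _.
    by rewrite in_itv/= divr_ge0//= ler_pdivrMr// mul1r ler_nat.
  rewrite lerD2l le_eqVlt; apply/orP; left; apply/eqP; field.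
  exact: lt0r_neq0.
have E : (bernstein n (fun k => e / 2 + K / n%:R ^+ 2 * (k%:R - n%:R * x) ^+ 2)).[x]
    <= e.
  rewrite (bernsteinD n (fun=> e / 2)
    (fun k => K / n%:R ^+ 2 * (k%:R - n%:R * x) ^+ 2)).
  rewrite bernstein_cst bernsteinZ bernstein_sqr subrr expr0n addr0.
  have -> : K / n%:R ^+ 2 * (n%:R * x * (1 - x)) = K / n%:R * (x * (1 - x)).
    by field; exact: lt0r_neq0.
  have k1 : K / n%:R <= e.
    by rewrite ler_pdivrMr// mulrC -ler_pdivrMr// ltW.
  have k2 : x * (1 - x) <= 1 / 2 by nra.
  have k3 : 0 <= x * (1 - x) by rewrite mulr_ge0//; lra.
  have : K / n%:R * (x * (1 - x)) <= e * (1 / 2).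
    by apply: ler_pM => //; rewrite divr_ge0// ltW.
  lra.
pose psi (k : nat) := e / 2 + K / n%:R ^+ 2 * (k%:R - n%:R * x) ^+ 2.
set phi := fun k : nat => _.
have B1 : (bernstein n phi).[x] <= f x + e.
  rewrite -[f x](bernstein_cst n (f x) x).
  apply: le_trans (lerD (lexx _) E); rewrite -bernsteinD.
  apply: bernstein_le => [|k kn]; first by rewrite x0.
  by have := bd k kn; rewrite ler_norml /= => /andP[+ _]; rewrite /phi; lra.
have B2 : f x <= (bernstein n phi).[x] + e.
  rewrite -[f x](bernstein_cst n (f x) x).
  apply: le_trans (lerD (lexx _) E); rewrite -bernsteinD.
  apply: bernstein_le => [|k kn]; first by rewrite x0.
  by have := bd k kn; rewrite ler_norml /= => /andP[_ +]; rewrite /phi; lra.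
by rewrite ler_norml; apply/andP; split; lra.
Qed.

Theorem weierstrass_approx (f : R -> R) (A e : R) : continuous f -> 0 < A ->
  0 < e -> exists p : {poly R}, forall x, x \in `[- A, A] -> `|f x - p.[x]| <= e.
Proof.
move=> cf A0 e0.
have [|p pP] := @bernstein_approx (fun t => f (A * (2 * t - 1))) e _ e0.
  move=> t; apply: continuous_comp; last exact: cf.
  apply: cvgMl_tmp; apply: cvgB; last exact: cvg_cst.
  by apply: cvgMl_tmp; exact: cvg_id.
exists (p \Po ((2 * A)^-1%:P * 'X + (1 / 2)%:P)) => x.
rewrite in_itv/= => /andP[x1 x2].
pose t := (2 * A)^-1 * x + 1 / 2.
have -> : (p \Po ((2 * A)^-1%:P * 'X + (1 / 2)%:P)).[x] = p.[t].
  by rewrite horner_comp hornerD hornerM !hornerC hornerX.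
have tx : A * (2 * t - 1) = x by rewrite /t; field; exact: lt0r_neq0.
rewrite -{1}tx; apply: pP; rewrite in_itv/=.
have : A * (2 * t - 1) <= A * 1 by rewrite tx mulr1.
have : A * (- 1) <= A * (2 * t - 1) by rewrite tx mulrN1.
by rewrite !ler_pM2l// => ? ?; apply/andP; split; lra.
Qed.

End weierstrass.

(** * Chebyshev polynomials and the semicircle law *)

Section semicircle_moments.
Context {R : realType}.
Implicit Types (x t : R) (j : nat).

Notation lebesgue := (@lebesgue_measure R).

(* The free parameters yield the Chebyshev polynomials of the second kind. *)
Definition cheb j x : R := jpol (fun=> 0) x j.+1.

Lemma cheb_sin j t : cheb j (2 * cos t) * sin t = sin (j.+1%:R * t).
Proof.
suff H : cheb j (2 * cos t) * sin t = sin (j.+1%:R * t) /\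
         cheb j.+1 (2 * cos t) * sin t = sin (j.+2%:R * t) by case: H.
elim: j => [|j [IH1 IH2]].
  rewrite /cheb jpolSS /jpol !mul1r subr0 subr0 mulr1; split=> //.
  have -> : 2 * t = t + t by ring.
  by rewrite sinD; ring.
split=> //.
transitivity (2 * cos t * (cheb j.+1 (2 * cos t) * sin t)
  - cheb j (2 * cos t) * sin t).
  by rewrite /cheb [jpol _ _ j.+3]jpolSS; ring.
rewrite IH2 IH1.
have -> : j.+3%:R * t = j.+2%:R * t + t by rewrite -[j.+3%:R]natr1; ring.
have -> : j.+1%:R * t = j.+2%:R * t - t by rewrite -[j.+2%:R]natr1; ring.
by rewrite !sinD sinN cosN; ring.
Qed.

Lemma sin_natpi j : sin (j%:R * pi : R) = 0.
Proof.
elim: j => [|j IH]; first by rewrite mul0r sin0.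
by rewrite -natr1 mulrDl mul1r sinDpi IH oppr0.
Qed.

Lemma cheb_continuous j : continuous (cheb j).
Proof. exact: jpol_continuous. Qed.

Lemma semicircle_continuous : continuous (@semicircle R).
Proof.
move=> x; apply: cvgMr_tmp; apply: continuous_comp; last exact: sqrt_continuous.
by apply: cvgB; [exact: cvg_cst|rewrite expr2; apply: cvgM; exact: cvg_id].
Qed.

(** A primitive of $\cos(jt)$; at $j = 0$ the general formula would be a division by zero, with
    value 0. *)
Definition sine_integral j t : R := if j is 0 then t else sin (j%:R * t) / j%:R.

Lemma is_derive_sine_integral j t :
  is_derive t 1 (sine_integral j) (cos (j%:R * t)).
Proof.
case: j => [|j]; first by rewrite mul0r cos0; exact: is_derive_id.
have D1 := is_deriveZ j.+1%:R (is_derive_id t (1 : R)).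
have D2 := is_derive1_comp (is_derive_sin (j.+1%:R *: t)) D1.
have := is_deriveZ j.+1%:R^-1 D2.
have -> : j.+1%:R^-1 \*: (sin \o (j.+1%:R \*: id)) = sine_integral j.+1.
  by apply/funext => s; rewrite /sine_integral mulrC.
move=> /is_derive_eq; apply; rewrite /GRing.scale/= mulr1 mulrC mulfK//.
Qed.

(** The substitution $x = 2 \cos t$ turns the integrand into $(2/\pi) \sin((j+1)t) \sin t =
    (\cos(jt) - \cos((j+2)t)) / \pi$, whose primitive [H] vanishes at 0, and also at $\pi$ unless $j
    = 0$. *)
Lemma semicircle_cheb j :
  (\int[lebesgue]_(x in `[(-2)%R, 2%R]) (cheb j x * semicircle x)%:E =
   ((j == 0)%:R)%:E)%E.
Proof.
pose F t : R := 2 * cos t.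
have dF t : is_derive t (1 : R) F (- 2 * sin t).
    apply: (is_derive_eq (is_deriveZ (2 : R) (is_derive_cos t))).
  by rewrite /GRing.scale/= mulrN mulNr.
have F'E : (derive1 F) = (fun t => - 2 * sin t).
  by apply/funext => t; rewrite derive1E; have [_ ->] := dF t.
have cF' : continuous (derive1 F).
  by rewrite F'E => t; apply: cvgMl_tmp; exact: continuous_sin.
have cF : continuous F.
  by move=> t; apply: cvgMl_tmp; exact: continuous_cos.
have pi0 := @pi_gt0 R.
have F0 : F 0 = 2 by rewrite /F cos0 mulr1.
have Fpi : F pi = -2 by rewrite /F cospi mulrN1.
rewrite -{1}Fpi -{1}F0.
rewrite (@integration_by_substitution_decreasing R F
  (fun x => cheb j x * semicircle x) 0 pi (ltW pi0)); first last.
- apply: continuous_subspaceT => x; apply: cvgM; first exact: cheb_continuous.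
  exact: semicircle_continuous.
- split.
  + by move=> t _; case: (dF t).
  + by apply: cvg_at_right_filter; exact: cF.
  + by apply: cvg_at_left_filter; exact: cF.
- by apply: (cvgP ((derive1 F) pi)); apply: cvg_at_left_filter; exact: cF'.
- by apply: (cvgP ((derive1 F) 0)); apply: cvg_at_right_filter; exact: cF'.
- by move=> t _; exact: cF'.
- by move=> s t sI tI st; rewrite /F ltr_pM2l// ltr_cos.
pose H t := pi^-1 * (sine_integral j t - sine_integral j.+2 t).
have dH t : is_derive t (1 : R) H
    (pi^-1 * (cos (j%:R * t) - cos (j.+2%:R * t))).
  exact: (is_deriveZ pi^-1 (is_deriveB (is_derive_sine_integral j t)
    (is_derive_sine_integral j.+2 t))).
have H'E : derive1 H = (fun t => pi^-1 * (cos (j%:R * t) - cos (j.+2%:R * t))).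
  by apply/funext => t; rewrite derive1E; have [_ ->] := dH t.
have cH : continuous H.
  by move=> t; apply/differentiable_continuous/derivable1_diffP; case: (dH t).
have cH' : continuous (derive1 H).
  rewrite H'E => t; apply: cvgMl_tmp; apply: cvgB;
    (apply: continuous_comp; [apply: cvgMl_tmp; exact: cvg_id|exact: continuous_cos]).
have IE t : t \in `[0, pi] ->
    (((fun x => cheb j x * semicircle x) \o F) * - derive1 F) t = derive1 H t.
  rewrite in_itv/= => /andP[t0 tpi].
  rewrite -[LHS]/(cheb j (F t) * semicircle (F t) * - derive1 F t) H'E F'E.
  transitivity (pi^-1 * (2 * (cheb j (F t) * sin t) * sin t)).
    rewrite /semicircle.
    have -> : 4 - F t ^+ 2 = (2 * sin t) ^+ 2.
      by rewrite /F !exprMn sin2cos2; ring.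
    rewrite sqrtr_sqr ger0_norm; last by rewrite mulr_ge0// sin_ge0_pi// t0.
    by have := lt0r_neq0 pi0; move: (pi : R) => p p0; field.
  rewrite /F cheb_sin.
  have -> : j%:R * t = j.+1%:R * t - t by rewrite -[j.+1%:R]natr1; ring.
  have -> : j.+2%:R * t = j.+1%:R * t + t by rewrite -[j.+2%:R]natr1; ring.
  by rewrite cosB cosD; ring.
transitivity (\int[lebesgue]_(t in `[0%R, pi]) (derive1 H t)%:E)%E.
  by apply: eq_integral => t; rewrite inE => tI; rewrite IE.
rewrite (@continuous_FTC2 R (derive1 H) H 0 pi pi0) => //; first last.
- split.
  + by move=> t _; case: (dH t).
  + by apply: cvg_at_right_filter; exact: cH.
  + by apply: cvg_at_left_filter; exact: cH.
- exact: continuous_subspaceT.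
rewrite -EFinB; congr EFin; rewrite /H; clear -j pi0; rewrite /sine_integral.
case: j => [|k].
  by rewrite sin_natpi mulr0 sin0 !mul0r !subr0 mulr0 subr0 eqxx mulVf// lt0r_neq0.
by rewrite !sin_natpi !mulr0 sin0 !mul0r subrr.
Qed.

End semicircle_moments.

(** * Integrals of continuous functions over a compact interval of finite measure *)

Section interval_integral.
Context {R : realType}.
Variable nu : {measure set (measurableTypeR R) -> \bar R}.
Variables c d : R.
Hypothesis nu_fin : (nu `[c, d]%classic < +oo)%E.

Lemma itv_continuous_integrable (f : R -> R) : continuous f ->
  nu.-integrable `[c, d]%classic (EFin \o f).
Proof.
move=> cf; apply: measurable_bounded_integrable => //.
- apply: measurable_funTS; exact: continuous_measurable_fun.
- have : bounded_set (f @` `[c, d]).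
    apply: compact_bounded; apply: continuous_compact; last exact: segment_compact.
    exact: continuous_subspaceT.
  move=> [M [Mr MP]]; exists M; split=> // y My x xI; apply: MP My _ _.
  by exists x.
Qed.

Local Notation E f := (Rintegral nu `[c, d]%classic f).

Lemma itv_RintegralD (f g : R -> R) : continuous f -> continuous g ->
  E (fun x => f x + g x) = E f + E g.
Proof.
by move=> cf cg; apply: RintegralD => //; exact: itv_continuous_integrable.
Qed.

Lemma itv_RintegralB (f g : R -> R) : continuous f -> continuous g ->
  E (fun x => f x - g x) = E f - E g.
Proof.
by move=> cf cg; apply: RintegralB => //; exact: itv_continuous_integrable.
Qed.

Lemma itv_RintegralZ (k : R) (f : R -> R) : continuous f ->
  E (fun x => k * f x) = k * E f.
Proof.
by move=> cf; apply: RintegralZl => //; exact: itv_continuous_integrable.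
Qed.

Lemma itv_Rintegral_dist (f g h : R -> R) :
  continuous f -> continuous g -> continuous h ->
  (forall x, x \in `[c, d] -> `|f x - g x| <= h x) -> `|E f - E g| <= E h.
Proof.
move=> cf cg ch fgh; rewrite -itv_RintegralB//.
have cfg : continuous (fun x => f x - g x).
  by move=> x; apply: cvgB; [exact: cf|exact: cg].
apply: (le_trans (le_normr_Rintegral _ _)) => //.
  exact: itv_continuous_integrable.
apply: le_Rintegral => //.
- by apply: itv_continuous_integrable => x; apply: cvg_norm; exact: cfg.
- exact: itv_continuous_integrable.
Qed.

End interval_integral.

(** * Continuity under pointwise operations *)

Section continuity.
Context {R : realType}.
Implicit Types f g : R -> R.

Lemma continuous_funM f g : continuous f -> continuous g ->
  continuous (fun x => f x * g x).
Proof. by move=> cf cg x; apply: cvgM; [exact: cf|exact: cg]. Qed.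

Lemma continuous_funD f g : continuous f -> continuous g ->
  continuous (fun x => f x + g x).
Proof. by move=> cf cg x; apply: cvgD; [exact: cf|exact: cg]. Qed.

Lemma continuous_funN f : continuous f -> continuous (fun x => - f x).
Proof. by move=> cf x; apply: cvgN; exact: cf. Qed.

Lemma continuous_funmax f g : continuous f -> continuous g ->
  continuous (fun x => Num.max (f x) (g x)).
Proof. by move=> cf cg x; exact: (continuous_max (cf x) (cg x)). Qed.

Lemma continuous_funmin f g : continuous f -> continuous g ->
  continuous (fun x => Num.min (f x) (g x)).
Proof. by move=> cf cg x; exact: (continuous_min (cf x) (cg x)). Qed.

Lemma continuous_funcst (k : R) : continuous (fun _ : R => k).
Proof. by move=> x; exact: cvg_cst. Qed.

Lemma continuous_funid : continuous (fun x : R => x).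
Proof. by move=> x; exact: cvg_id. Qed.

End continuity.

Ltac solve_continuous := repeat lazymatch goal with
  | |- continuous (fun x => (@?f x + @?g x)%R) => apply: (@continuous_funD _ f g)
  | |- continuous (fun x => (- @?f x)%R) => apply: (@continuous_funN _ f)
  | |- continuous (fun x => (@?f x * @?g x)%R) => apply: (@continuous_funM _ f g)
  | |- continuous (fun x => Num.max (@?f x) (@?g x)) =>
      apply: (@continuous_funmax _ f g)
  | |- continuous (fun x => Num.min (@?f x) (@?g x)) =>
      apply: (@continuous_funmin _ f g)
  | |- continuous (fun x => jpol ?b x ?n) => exact: jpol_continuous
  | |- continuous (fun x => cheb ?n x) => exact: cheb_continuous
  | |- continuous (fun x => turan ?b ?n x) => exact: turan_continuous
  | |- continuous (fun x => semicircle x) => exact: semicircle_continuous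
  | |- continuous (fun x => horner ?p x) => exact: continuous_horner
  | |- continuous (fun x => x) => exact: continuous_funid
  | |- continuous (fun _ => ?k) => exact: continuous_funcst
  | |- _ => assumption
  end.

(** * Weak convergence of $D_n d\mu$ to the semicircle law *)

Section turan_weak_limit.
Context {R : realType} {b : nat -> R}.
Variable mu : {measure set (measurableTypeR R) -> \bar R}.
Variable A : R.
Hypothesis A2 : 2 <= A.
Hypothesis mu_fin : (mu `[(- A)%R, A]%classic < +oo)%E.
Hypothesis b_cvg0 : b @ \oo --> (0 : R).

Local Notation E f := (Rintegral mu `[(- A)%R, A]%classic f).

Hypothesis ortho : forall m n,
  E (fun x => jpol b x m.+1 * jpol b x n.+1) = (m == n)%:R.

Notation lebesgue := (@lebesgue_measure R).
Local Notation L f :=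
  (Rintegral lebesgue `[(- 2)%R, 2%R]%classic (fun x => f x * semicircle x)).

Let lebesgue_fin : (lebesgue `[(- 2)%R, 2%R]%classic < +oo)%E.
Proof. by rewrite lebesgue_measure_itv/=; case: ifPn => //; rewrite ltry. Qed.

Lemma Rintegral_cheb j : L (cheb j) = (j == 0)%:R.
Proof. by rewrite /Rintegral semicircle_cheb. Qed.

(* [c j] is the entry at distance [j] from the diagonal of $p(J_0)$, where $J_0$
   is the free Jacobi matrix on the whole line. *)
Lemma matrix_element_limit (p : {poly R}) : exists c : nat -> R,
  (forall j, E (fun x => p.[x] * (jpol b x n.+1 * jpol b x (n.+1 + j)))
     @[n --> \oo] --> c j) /\
  (forall j, L (fun x => p.[x] * cheb j x) = c j - c j.+2).
Proof.
elim/poly_ind: p => [|p k [c [cE cL]]].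
  exists (fun=> 0); split=> j.
    under eq_fun do under eq_Rintegral do rewrite horner0 mul0r.
    by under eq_fun do rewrite Rintegral_cst// mul0r; exact: cvg_cst.
  under eq_Rintegral do rewrite horner0 !mul0r.
  by rewrite Rintegral_cst// mul0r subr0.
(* Multiplication by $x$ adds the two neighbouring entries. For $j = 0$ the left neighbour is at
   distance $-1$, which by symmetry is [c 1]. *)
exists (fun j => (if j is i.+1 then c i else c 1%N) + c j.+1 + k * (j == 0)%:R).
split=> j.
  rewrite -cvg_shiftS.
  (* The factor $x$ is moved onto $p_{n+1}$: $x p_{n+1} = p_{n+2} + b_{n+2} p_{n+1} + p_n$. *)
  have Eq n : E (fun x => (p * 'X + k%:P).[x] *
        (jpol b x n.+2 * jpol b x (n.+2 + j))) =
      E (fun x => p.[x] * (jpol b x n.+3 * jpol b x (n.+2 + j))) +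
      b n.+2 * E (fun x => p.[x] * (jpol b x n.+2 * jpol b x (n.+2 + j))) +
      E (fun x => p.[x] * (jpol b x n.+1 * jpol b x (n.+1 + j.+1))) +
      k * (0%N == j)%:R.
    have -> : (0%N == j)%:R =
        E (fun x => jpol b x n.+2 * jpol b x (n.+2 + j)).
      rewrite ortho; congr (nat_of_bool _)%:R; apply/esym.
      by rewrite -[X in X == _]addn0 eqn_add2l.
    pose F1 x := p.[x] * (jpol b x n.+3 * jpol b x (n.+2 + j)).
    pose F2 x := p.[x] * (jpol b x n.+2 * jpol b x (n.+2 + j)).
    pose F3 x := p.[x] * (jpol b x n.+1 * jpol b x (n.+1 + j.+1)).
    pose F4 x := jpol b x n.+2 * jpol b x (n.+2 + j).
    have c1 : continuous F1 by rewrite /F1; solve_continuous.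
    have c2 : continuous F2 by rewrite /F2; solve_continuous.
    have c3 : continuous F3 by rewrite /F3; solve_continuous.
    have c4 : continuous F4 by rewrite /F4; solve_continuous.
    have c2' : continuous (fun x => b n.+2 * F2 x) by solve_continuous.
    have c4' : continuous (fun x => k * F4 x) by solve_continuous.
    have c12 : continuous (fun x => F1 x + b n.+2 * F2 x) by solve_continuous.
    have c123 : continuous (fun x => F1 x + b n.+2 * F2 x + F3 x).
      by solve_continuous.
    rewrite -/F1 -/F2 -/F3 -/F4 -(itv_RintegralZ mu_fin _ c2).
    rewrite -(itv_RintegralZ mu_fin _ c4) -(itv_RintegralD mu_fin c1 c2').
    rewrite -(itv_RintegralD mu_fin c12 c3) -(itv_RintegralD mu_fin c123 c4').
    apply: eq_Rintegral => x _; rewrite hornerMXaddC /F1 /F2 /F3 /F4 addnS.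
    rewrite [jpol b x n.+3]jpolSS -[(n.+1 + j).+1]/(n.+2 + j)%N.
    move: (jpol b x (n.+2 + j)) (jpol b x n.+2) (jpol b x n.+1) => u v w.
    by ring.
  have -> : (j == 0)%:R = (0%N == j)%:R :> R by rewrite eq_sym.
  rewrite /=; under eq_fun do rewrite Eq.
  apply: cvgD; last exact: cvg_cst.
  apply: cvgD; last exact: cE.
  rewrite -[X in _ --> X]addr0; apply: cvgD.
    case: j {Eq} => [|j].
      have := cE 1%N; rewrite -cvg_shiftS => /=; apply: cvg_trans.
      apply: near_eq_cvg; near=> n; apply: eq_Rintegral => x _.
      by rewrite addn0 addn1; congr (_ * _); exact: mulrC.
    have := cE j; rewrite -(cvg_shiftn 2); apply: cvg_trans.
    apply: near_eq_cvg; near=> n; apply: eq_Rintegral => x _.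
    by rewrite addn2 addnS.
  (* The diagonal term disappears in the limit, as $b_{n+2} \to 0$ while the integral next to it
     converges. *)
  rewrite -[X in _ --> X](mul0r (c j)); apply: cvgM.
    by have := b_cvg0; rewrite -(cvg_shiftn 2); under eq_fun do rewrite addn2.
  by have := cE j; rewrite -cvg_shiftS.
have HL n : L (fun x => p.[x] * cheb n x) = c n - c n.+2 := cL n.
have G i : continuous (fun x => p.[x] * cheb i x * semicircle x).
  by solve_continuous.
have kG : continuous (fun x => k * (cheb j x * semicircle x)).
  by solve_continuous.
(* On the limit side $x U_j = U_{j+1} + U_{j-1}$ with $U_{-1} = 0$; correspondingly, for $j = 0$ the
   reflected [c 1] cancels and leaves $c_1 - c_3$. *)
transitivity (L (fun x => p.[x] * cheb j.+1 x) +
    (if j is i.+1 then L (fun x => p.[x] * cheb i x) else 0) + k * L (cheb j)).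
  have cj : continuous (fun x : R => cheb j x * semicircle x).
    by solve_continuous.
  rewrite -(itv_RintegralZ lebesgue_fin _ cj).
  case: j {cj} kG => [|j] kG.
    rewrite addr0 -(itv_RintegralD lebesgue_fin (G 1%N) kG).
    apply: eq_Rintegral => x _; rewrite hornerMXaddC /cheb [jpol _ x 2]jpolSS.
    by rewrite /jpol; ring.
  rewrite -(itv_RintegralD lebesgue_fin (G j.+2) (G j)).
  have GG : continuous (fun x => p.[x] * cheb j.+2 x * semicircle x +
    p.[x] * cheb j x * semicircle x) by solve_continuous.
  rewrite -(itv_RintegralD lebesgue_fin GG kG).
  apply: eq_Rintegral => x _; rewrite hornerMXaddC /cheb [jpol _ x j.+3]jpolSS.
  by ring.
rewrite Rintegral_cheb HL; case: j kG => [|j] _ /=; last by rewrite HL; ring.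
by rewrite ?eqxx ?mulr1; ring.
Unshelve. all: by end_near.
Qed.

(** $D_n = p_n^2 - p_{n+1} p_{n-1}$ is a product at distance 0 minus one at distance 2, so the limit
    is $c_0 - c_2$, which is the integral against $U_0 = 1$. *)
Lemma turan_polynomial_limit (p : {poly R}) :
  E (fun x => p.[x] * turan b n x) @[n --> \oo] --> L (horner p).
Proof.
have [c [cE cL]] := matrix_element_limit p.
have -> : L (horner p) = c 0%N - c 2%N.
  rewrite -cL; apply: eq_Rintegral => x _.
  by rewrite /cheb [jpol _ x 1]/jpol mulr1.
(* The shift avoids $D_0$, in which $p_{-1}$ occurs. *)
rewrite -cvg_shiftS.
have Eq n : E (fun x => p.[x] * turan b n.+1 x) =
    E (fun x => p.[x] * (jpol b x n.+2 * jpol b x (n.+2 + 0))) -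
    E (fun x => p.[x] * (jpol b x n.+1 * jpol b x (n.+1 + 2))).
  have c1 : continuous (fun x : R => p.[x] * (jpol b x n.+2 * jpol b x (n.+2 + 0))).
    by solve_continuous.
  have c2 : continuous (fun x : R => p.[x] * (jpol b x n.+1 * jpol b x (n.+1 + 2))).
    by solve_continuous.
  rewrite -(itv_RintegralB mu_fin c1 c2); apply: eq_Rintegral => x _.
  by rewrite turanE addn0 addn2; ring.
rewrite [X in X @ _ --> _](_ : _ = fun n : nat =>
  E (fun x => p.[x] * (jpol b x n.+2 * jpol b x (n.+2 + 0))) -
  E (fun x => p.[x] * (jpol b x n.+1 * jpol b x (n.+1 + 2)))); last first.
  by apply/funext => n; exact: Eq.
apply: cvgB; last exact: cE.
have := cE 0%N; rewrite -cvg_shiftS; exact: cvg_trans.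
Qed.

(** $|D_n| \le p_n^2 + (p_{n+1}^2 + p_{n-1}^2) / 2$, and each square has integral at most 1. The
    absolute value matters, as $D_n$ may change sign on $[-A, A]$. *)
Lemma turan_variation_bound (f : R -> R) (e : R) n : continuous f -> 0 <= e ->
  (forall x, x \in `[- A, A] -> `|f x| <= e) ->
  `|E (fun x => f x * turan b n x)| <= 2 * e.
Proof.
move=> cf e0 fe.
have c0 : continuous (fun _ : R => 0 : R) by exact: continuous_funcst.
pose F k (x : R) := jpol b x k * jpol b x k.
have cF k : continuous (F k) by rewrite /F; solve_continuous.
have EF k : E (F k) = (0 < k)%:R.
  case: k => [|k].
    rewrite /Rintegral integral0_eq// => x _.
    by rewrite /F [jpol _ _ 0]/jpol mul0r.
  by rewrite /F ortho eqxx.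
have E1 k : E (F k) <= 1 by rewrite EF; case: k.
pose h (x : R) := e * (F n.+1 x + 2^-1 * (F n.+2 x + F n x)).
have ch2 : continuous (fun x => F n.+2 x + F n x) by apply: continuous_funD.
have ch1 : continuous (fun x => 2^-1 * (F n.+2 x + F n x)) by solve_continuous.
have ch0 : continuous (fun x => F n.+1 x + 2^-1 * (F n.+2 x + F n x)).
  by apply: continuous_funD.
have ch : continuous h by rewrite /h; apply: continuous_funM => //; solve_continuous.
have cfT : continuous (fun x => f x * turan b n x)
  by apply: continuous_funM => //; exact: turan_continuous.
have Eh : E h <= 2 * e.
  rewrite /h (itv_RintegralZ mu_fin e ch0) (itv_RintegralD mu_fin (cF _) ch1).
  rewrite (itv_RintegralZ mu_fin _ ch2) (itv_RintegralD mu_fin (cF _) (cF _)).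
  rewrite mulrC ler_wpM2r//.
  have := E1 n.+1; have := E1 n.+2; have := E1 n; lra.
apply: le_trans Eh.
have E0 : E (fun=> 0) = 0 by rewrite Rintegral_cst// mul0r.
have := itv_Rintegral_dist mu_fin cfT c0 ch; rewrite E0 subr0; apply => x xI.
rewrite subr0 normrM.
apply: ler_pM => //; first exact: fe.
rewrite turanE /F ler_norml.
move: (jpol b x n.+1) (jpol b x n.+2) (jpol b x n) => u v w.
have h1 := sqr_ge0 (v - w); have h2 := sqr_ge0 (v + w); have h3 := sqr_ge0 u.
by apply/andP; split; nra.
Qed.

Lemma turan_weak_limit (f : R -> R) : continuous f ->
  E (fun x => f x * turan b n x) @[n --> \oo] --> L f.
Proof.
move=> cf; apply/cvgrPdist_le => e e0.
(* One quarter for replacing [f] by [p] under the semicircle law, one for the polynomial limit, and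
   two for the same replacement under $D_n d\mu$, of total variation at most 2. *)
have e40 : 0 < e / 4 by rewrite divr_gt0.
have A0 : 0 < A by apply: lt_le_trans A2.
have [p pP] := weierstrass_approx cf A0 e40.
have /cvgrPdist_le /(_ _ e40) := @turan_polynomial_limit p.
have cp : continuous (horner p) := @continuous_horner _ p.
have cfp : continuous (fun x => f x - p.[x]) by solve_continuous.
have cfs : continuous (fun x => f x * semicircle x) by solve_continuous.
have cps : continuous (fun x => p.[x] * semicircle x) by solve_continuous.
have Lfp : `|L f - L (horner p)| <= e / 4.
  have cs : continuous (fun x : R => cheb 0 x * semicircle x) by solve_continuous.
  have ce : continuous (fun x : R => e / 4 * (cheb 0 x * semicircle x)).
    by solve_continuous.
  (* The semicircle law has mass 1 and [cheb 0] is the constant 1. *)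
  have -> : e / 4 = L (fun x => e / 4 * cheb 0 x).
    transitivity (e / 4 * L (cheb 0)); first by rewrite Rintegral_cheb mulr1.
    rewrite -(itv_RintegralZ lebesgue_fin _ cs).
    by apply: eq_Rintegral => x _; rewrite mulrA.
  under [leRHS]eq_Rintegral do rewrite -mulrA.
  apply: itv_Rintegral_dist => // x; rewrite in_itv/= => /andP[x1 x2].
  have -> : cheb 0 x = 1 by [].
  have s0 : 0 <= semicircle x :> R.
    by rewrite divr_ge0 ?sqrtr_ge0// mulr_ge0// pi_ge0.
  rewrite -mulrBl normrM (ger0_norm s0) mul1r ler_wpM2r// pP// in_itv/=.
  by rewrite (le_trans x2 A2) andbT (le_trans _ x1)// lerN2.
apply: filterS => n Hn.
have cT1 : continuous (fun x => f x * turan b n x) by solve_continuous.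
have cT2 : continuous (fun x => p.[x] * turan b n x) by solve_continuous.
have Hd : `|E (fun x => f x * turan b n x) - E (fun x => p.[x] * turan b n x)|
    <= 2 * (e / 4).
  rewrite -(itv_RintegralB mu_fin cT1 cT2).
  under eq_Rintegral do rewrite -mulrBl.
  exact: (turan_variation_bound n cfp (ltW e40)).
move: (L f) (L (horner p)) (E (fun x => f x * turan b n x))
  (E (fun x => p.[x] * turan b n x)) Lfp Hn Hd => u v w z.
rewrite !ler_norml => /andP[? ?] /andP[? ?] /andP[? ?].
by apply/andP; split; lra.
Qed.

End turan_weak_limit.

(** * Identification of a measure by its values on open intervals *)

Section density_uniqueness.
Context {R : realType}.
Variables (w : R -> R).
Hypothesis w_meas : measurable_fun setT w.
Hypothesis w_ge0 : forall x, 0 <= w x.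

Let density_measure (A : set (measurableTypeR R)) : \bar R :=
  (\int[@lebesgue_measure R]_(x in A) (w x)%:E)%E.

Let density_measure0 : density_measure set0 = 0%E.
Proof. by rewrite /density_measure integral_set0. Qed.

Let density_measure_ge0 A : (0 <= density_measure A)%E.
Proof. by apply: integral_ge0 => x _; rewrite lee_fin. Qed.

Let density_measure_sigma_additive : semi_sigma_additive density_measure.
Proof.
apply: semi_sigma_additive_nng_induced => [|x]; first exact/measurable_EFinP.
by rewrite lee_fin.
Qed.

HB.instance Definition _ := isMeasure.Build _ (measurableTypeR R) R
  density_measure density_measure0 density_measure_ge0
  density_measure_sigma_additive.

(** Both measures are restricted to $]l, r[$ and compared on the open intervals, which are stable
    under intersection and generate the Borel sets; meeting one with $]l, r[$ gives an interval to
    which the hypothesis applies. *)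
Lemma density_on_open_itvs (mu : {measure set (measurableTypeR R) -> \bar R})
    (l r : R) : (mu `]l, r[%classic < +oo)%E ->
  (forall a c, l <= a -> c <= r -> mu `]a, c[%classic =
     (\int[@lebesgue_measure R]_(x in `]a, c[) (w x)%:E)%E) ->
  forall A : set (measurableTypeR R), measurable A -> A `<=` `]l, r[ ->
    mu A = (\int[@lebesgue_measure R]_(x in A) (w x)%:E)%E.
Proof.
move=> mu_fin muE A mA Alr.
have mI : measurable (`]l, r[%classic : set (measurableTypeR R)).
  exact: measurable_itv.
have itvI a c a' c' : `]a, c[ `&` `]a', c'[ =
    `](Num.max a a'), (Num.min c c')[%classic :> set R.
  apply/seteqP; split=> x /=; rewrite !in_itv/= gt_max lt_min.
    by move=> [/andP[-> ->] /andP[-> ->]].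
  by move=> /andP[/andP[-> ->] /andP[-> ->]].
pose m1 : {measure set (measurableTypeR R) -> \bar R} := mrestr mu mI.
pose m2 : {measure set (measurableTypeR R) -> \bar R} := mrestr density_measure mI.
suff: m1 A = m2 A by rewrite /m1/= /m2/= /mrestr (setIidl Alr).
have := @measure_unique _ R (measurableTypeR R) (@RGenOpens.G R)
  (fun k => `](- k%:R)%R, k%:R[%classic) (RGenOpens.measurableE R)
  _ _ _ m1 m2 _ _ A mA; apply.
- move=> _ _ [a [c ->]] [a' [c' ->]]; exists (Num.max a a'), (Num.min c c').
  by rewrite itvI.
- by move=> k; exists (- k%:R), k%:R.
- apply/seteqP; split=> // x _; exists (Num.truncn `|x|).+1 => //=.
  by rewrite in_itv/= -ltr_norml truncnS_gt.
- move=> _ [a [c ->]]; rewrite /m1/= /m2/= /mrestr itvI.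
  by apply: muE; rewrite ?le_max ?ge_min lexx orbT.
- move=> k; apply: le_lt_trans mu_fin; rewrite /m1/= /mrestr; apply: le_measure.
  + by rewrite inE; apply: measurableI.
  + by rewrite inE.
  + exact: subIsetr.
Qed.

End density_uniqueness.

(** * Reduction to a compact interval, and tent functions *)

Section spectral.
Context {R : realType}.
Implicit Types (b : nat -> R) (mu : probability (measurableTypeR R) R).

(** Taking $A \ge 2$ makes $[-A, A]$ also contain the support of the semicircle law. *)
Lemma compact_support_itv mu : compactly_supported mu ->
  exists2 A : R, 2 <= A & mu (~` `[- A, A]) = 0%E.
Proof.
move=> [K cK muK]; have [M [Mr MP]] := compact_bounded cK.
pose A := Num.max 2 (M + 1).
have A2 : 2 <= A by rewrite le_max lexx.
have AM : M < A by rewrite lt_max ltrDl ltr01 orbT.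
exists A => //; apply/eqP; rewrite eq_le measure_ge0 andbT -muK.
apply: le_measure; rewrite ?inE.
- by apply: measurableC; exact: measurable_itv.
- by apply: measurableC; exact: compact_measurable.
- apply: subsetC => x Kx; rewrite /= in_itv/= -ler_norml.
  exact: (MP _ AM).
Qed.

Lemma jacobi_jpol b (p : nat -> {poly R}) : jacobi_recurrence (fun=> 1) b p ->
  forall n x, (p n).[x] = jpol b x n.+1.
Proof.
move=> [p0 pS] n x.
suff: (p n).[x] = jpol b x n.+1 /\ (p n.+1).[x] = jpol b x n.+2 by case.
have E k : (p k.+1).[x] = (x - b k.+1) * (p k).[x]
    - (if k is m.+1 then (p m).[x] else 0).
  have := congr1 (fun r : {poly R} => r.[x]) (pS k).
  rewrite /= hornerM hornerX !hornerD !hornerZ mul1r => H.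
  rewrite mulrBl H; case: k H => [|k] _; first by rewrite horner0; ring.
  by rewrite hornerZ mul1r; ring.
elim: n => [|n [IH1 IH2]].
  by rewrite E p0 hornerC jpolSS /jpol.
by split=> //; rewrite E IH1 IH2 jpolSS.
Qed.

Lemma integral_on_support mu (A : R) (f : R -> R) : mu (~` `[- A, A]) = 0%E ->
  continuous f ->
  (\int[mu]_x (f x)%:E = (Rintegral mu `[(- A)%R, A]%classic f)%:E)%E.
Proof.
move=> muA cf.
have mI : measurable (`[(- A)%R, A]%classic : set (measurableTypeR R)).
  exact: measurable_itv.
have mu_fin : (mu `[(- A)%R, A]%classic < +oo)%E.
  by rewrite ltey_eq fin_num_measure.
have fi := itv_continuous_integrable mu_fin cf.
have TI : [set: measurableTypeR R] `\` ~` `[(- A)%R, A]%classic =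
    `[(- A)%R, A]%classic by rewrite setDE setCK setTI.
have mf : measurable_fun [set: measurableTypeR R] (EFin \o f).
  by apply/measurable_EFinP; exact: continuous_measurable_fun.
rewrite (@negligible_integral _ _ _ mu _ (~` `[(- A)%R, A]%classic)) //.
- by rewrite TI /Rintegral fineK//; exact: integrable_fin_num.
- exact: measurableC.
- apply/(@negligible_integrable _ _ _ mu _ (~` `[(- A)%R, A]%classic)) => //.
    exact: measurableC.
  by rewrite TI.
Qed.

(* Increases with [k] to the indicator of ]a, c[, its support being a compact
   subset of ]a, c[. *)
Definition tent (a c : R) (k : nat) (x : R) : R :=
  Num.max 0 (Num.min 1 (Num.min (k.+1%:R * (x - a) - 1) (k.+1%:R * (c - x) - 1))).

Lemma tent_ge0 a c k x : 0 <= tent a c k x.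
Proof. by rewrite le_max lexx. Qed.

Lemma tent_continuous a c k : continuous (tent a c k).
Proof.
by rewrite /tent; solve_continuous.
Qed.

Lemma tent_neq0 a c k x : tent a c k x != 0 ->
  a + k.+1%:R^-1 < x < c - k.+1%:R^-1.
Proof.
move=> t0; have : 0 < tent a c k x by rewrite lt_neqAle eq_sym t0 tent_ge0.
have k0 : (0 : R) < k.+1%:R by rewrite ltr0n.
rewrite lt_max ltxx/= !lt_min ltr01/= => /andP[h1 h2].
have {}h1 : k.+1%:R^-1 < x - a.
  by rewrite -(ltr_pM2l k0) mulfV ?lt0r_neq0// -subr_gt0.
have {}h2 : k.+1%:R^-1 < c - x.
  by rewrite -(ltr_pM2l k0) mulfV ?lt0r_neq0// -subr_gt0.
move: h1 h2; clear; move: (k.+1%:R^-1) => e h1 h2.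
by apply/andP; split; lra.
Qed.

(** Where the smaller tent is nonzero, $x - a$ and $c - x$ are positive, so both slopes help. *)
Lemma tent_nondecreasing a c x m n : (m <= n)%N -> tent a c m x <= tent a c n x.
Proof.
move=> mn; have [->|t0] := eqVneq (tent a c m x) 0; first exact: tent_ge0.
have /andP[x1 x2] := tent_neq0 t0.
have m0 : (0 : R) < m.+1%:R^-1 by rewrite invr_gt0 ltr0n.
have xa : 0 < x - a by rewrite subr_gt0 (lt_trans _ x1)// ltrDl.
have cx : 0 < c - x by rewrite subr_gt0 (lt_trans x2)// ltrBlDr ltrDl.
have mn' : m.+1%:R <= n.+1%:R :> R by rewrite ler_nat.
rewrite /tent ge_max !le_max lexx/=; apply/orP; right.
rewrite le_min ge_min lexx/= le_min; apply/andP; split.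
  rewrite ge_min; apply/orP; right; rewrite ge_min; apply/orP; left.
  by rewrite lerD2r ler_pM2r.
rewrite ge_min; apply/orP; right; rewrite ge_min; apply/orP; right.
by rewrite lerD2r ler_pM2r.
Qed.

Lemma tent_cvg a c x : tent a c ^~ x @ \oo --> (\1_(`]a, c[%classic) x : R).
Proof.
rewrite indicE; have [xac|xac] := boolP (x \in `]a, c[%classic).
  move: xac; rewrite inE/= in_itv/= => /andP[x1 x2].
  have [e0 e1 e2] : [/\ 0 < Num.min (x - a) (c - x),
    Num.min (x - a) (c - x) <= x - a & Num.min (x - a) (c - x) <= c - x].
    by rewrite lt_min !subr_gt0 x1 x2 !ge_min !lexx orbT.
  move: (Num.min _ _) e0 e1 e2 => e e0 e1 e2.
  (* From here on $(k + 1) e \ge 2$, so that both affine pieces are at least 1 and the tent equals 1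
     at [x]. *)
  apply: cvg_near_cst; exists (Num.truncn (2 / e)) => // k /= hk.
  have ke : 2 <= k.+1%:R * e.
    rewrite -ler_pdivrMr// ltW//; apply: lt_le_trans (truncnS_gt _) _.
    by rewrite ler_nat ltnS.
  have k0 : (0 : R) < k.+1%:R by rewrite ltr0n.
  have h1 : k.+1%:R * e <= k.+1%:R * (x - a) by rewrite ler_pM2l.
  have h2 : k.+1%:R * e <= k.+1%:R * (c - x) by rewrite ler_pM2l.
  rewrite /tent min_l; first by rewrite max_r.
  by rewrite le_min; apply/andP; split; lra.
apply: cvg_near_cst; apply: nearW => k; apply/eqP; apply: contraNT xac.
move=> /tent_neq0 /andP[x1 x2]; rewrite inE/= in_itv/=.
have k0 : (0 : R) < k.+1%:R^-1 by rewrite invr_gt0 ltr0n.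
by move: x1 x2 k0; move: (k.+1%:R^-1) => e *; apply/andP; split; lra.
Qed.

(** Monotone convergence; it serves both for [mu] with [w] equal to 1 and for Lebesgue measure with
    the cut weight. *)
Lemma integral_tent_cvg (nu : {measure set (measurableTypeR R) -> \bar R})
    (w : R -> R) (a c : R) : measurable_fun setT w -> (forall x, 0 <= w x) ->
  (\int[nu]_x (tent a c k x * w x)%:E @[k --> \oo] -->
   \int[nu]_(x in `]a, c[) (w x)%:E)%E.
Proof.
move=> mw w0.
have /= := @cvg_monotone_convergence _ _ R nu setT measurableT
  (fun k x => (tent a c k x * w x)%:E).
have -> : (\int[nu]_(x in `]a, c[) (w x)%:E =
    \int[nu]_x limn (fun k => (tent a c k x * w x)%:E))%E.
  rewrite integral_mkcond; apply: eq_integral => x _.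
  apply/esym/cvg_lim => //.
  rewrite patchE (_ : (if _ then _ else _) = (\1_(`]a, c[%classic) x * w x)%:E).
    by apply: cvg_EFin; [exact: nearW|apply: cvgMr_tmp; exact: tent_cvg].
  by rewrite indicE; case: ifPn => _; rewrite ?mul1r ?mul0r.
apply.
- move=> k; apply/measurable_EFinP; apply: measurable_funM => //.
  by apply: continuous_measurable_fun; exact: tent_continuous.
- by move=> k x _; rewrite lee_fin mulr_ge0 ?tent_ge0.
- by move=> x _ m n mn; rewrite lee_fin ler_wpM2r ?tent_nondecreasing.
Qed.

End spectral.

(** * The density of the spectral measure on $]-2, 2[$ *)

Section spectral_density.
Context {R : realType} {b : nat -> R}.
Hypothesis b_nd : forall n, b n.+1 <= b n.+2.
Hypothesis b_lt0 : forall n, b n.+1 < 0.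
Hypothesis b_cvg0 : b @ \oo --> (0 : R).

Lemma weight_continuous x : -2 < x < 2 -> {for x, continuous (weight b)}.
Proof.
move=> x12; apply: cvgM; first exact: semicircle_continuous.
apply: cvgV; first by rewrite lt0r_neq0// turan_lim_gt0.
exact: turan_lim_continuous.
Qed.

(* [weight] takes junk values outside of ]-2, 2[. *)
Definition cut_weight : R -> R := weight b \_ `]-2, 2[.

Lemma cut_weightE x : -2 < x < 2 -> cut_weight x = weight b x.
Proof. by move=> x12; rewrite /cut_weight patchE mem_setE in_itv/= x12. Qed.

Lemma cut_weight_out x : ~~ (-2 < x < 2) -> cut_weight x = 0.
Proof.
by move=> x12; rewrite /cut_weight patchE mem_setE in_itv/= (negbTE x12).
Qed.

Lemma cut_weight_ge0 x : 0 <= cut_weight x.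
Proof.
have [x12|x12] := boolP (-2 < x < 2); last by rewrite cut_weight_out.
by rewrite cut_weightE// ltW// weight_gt0.
Qed.

Lemma weight_measurable : measurable_fun (`]-2, 2[%classic : set R) (weight b).
Proof.
apply: open_continuous_measurable_fun; first exact: interval_open.
by move=> x; rewrite inE/= in_itv/=; exact: weight_continuous.
Qed.

Lemma cut_weight_measurable : measurable_fun setT cut_weight.
Proof.
by apply/measurable_restrict => //; rewrite ?setTI; exact: weight_measurable.
Qed.

Variable mu : probability (measurableTypeR R) R.
Hypothesis mu_spectral : is_spectral_measure (fun=> 1) b mu.

(** Projection onto $[c, d]$; composed with it, [turan_lim] becomes continuous and positive on the
    whole line. *)
Let clamp (c d x : R) := Num.max c (Num.min d x).

(** With $F = \varphi / D$, the integrals $\int F D_n d\mu$ have two limits: $\int F \rho\,dx$ by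
    weak convergence, and $\int \varphi\,d\mu$ by uniform convergence of $D_n$ to $D$ on
    $[c, d]$. *)
Lemma integral_test_function (phi : R -> R) (c d : R) : continuous phi ->
  -2 < c -> c <= d -> d < 2 -> (forall x, phi x != 0 -> c <= x <= d) ->
  (\int[mu]_x (phi x)%:E =
   \int[@lebesgue_measure R]_x (phi x * cut_weight x)%:E)%E.
Proof.
move=> cphi c2 cd d2 phi0; have [muK [p [_ orth] rec]] := mu_spectral.
have [A A2 muA] := compact_support_itv muK.
have mu_fin : (mu `[(- A)%R, A]%classic < +oo)%E.
  by rewrite ltey_eq fin_num_measure//; exact: measurable_itv.
have ortho m n : Rintegral mu `[(- A)%R, A]%classic
    (fun x => jpol b x m.+1 * jpol b x n.+1) = (m == n)%:R.
  apply: EFin_inj; rewrite -(orth m n) -(integral_on_support muA); last first.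
    by solve_continuous.
  by apply: eq_integral => x _; rewrite !(jacobi_jpol rec).
rewrite (integral_on_support muA cphi).
have clampI x : clamp c d x \in `[c, d].
  by rewrite in_itv/= /clamp le_max lexx/= ge_max cd ge_min lexx.
have clamp_id x : c <= x <= d -> clamp c d x = x.
  by move=> /andP[cx xd]; rewrite /clamp min_r// max_r.
have clamp12 x : -2 < clamp c d x < 2.
  have := clampI x; rewrite in_itv/= => /andP[h1 h2].
  by rewrite (lt_le_trans c2 h1) (le_lt_trans h2 d2).
have cclamp : continuous (clamp c d) by rewrite /clamp; solve_continuous.
pose F x := phi x / turan_lim b (clamp c d x).
have cF : continuous F.
  move=> x; apply: cvgM; first exact: cphi.
  apply: cvgV; first by rewrite lt0r_neq0// turan_lim_gt0.
  apply: (@continuous_comp _ _ _ (clamp c d) (turan_lim b)); first exact: cclamp.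
  exact: turan_lim_continuous.
have Fphi x : F x * turan_lim b (clamp c d x) = phi x.
  by rewrite /F divfK// lt0r_neq0// turan_lim_gt0.
have lim1 := @turan_weak_limit R b mu A A2 mu_fin b_cvg0 ortho F cF.
have lim2 : Rintegral mu `[(- A)%R, A]%classic (fun x => F x * turan b n x)
    @[n --> \oo] --> Rintegral mu `[(- A)%R, A]%classic phi.
  have [K [m0 KP]] := turan_lim_unif b_nd b_lt0 b_cvg0 c2 cd d2.
  have cnF : {within `[- A, A], continuous (fun x => `|F x|)}.
    by apply: continuous_subspaceT => x; apply: cvg_norm; exact: cF.
  have AA : - A <= A by rewrite ge0_cp// (le_trans _ A2).
  have [z _ zM] := @EVT_max R (fun x => `|F x|) (- A) A AA cnF.
  set V := fine (mu `[(- A)%R, A]%classic).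
  have V0 : 0 <= V by rewrite fine_ge0.
  pose B := `|F z| * `|K| * V + 1.
  have B0 : 0 < B by rewrite ltr_pwDr// !mulr_ge0.
  apply/cvgrPdist_le => e e0.
  have [|m1 m1P] := @b_near0 _ _ b_cvg0 (e / B); first by rewrite divr_gt0.
  exists (maxn m0 m1) => // n /= mn.
  have nm0 : (m0 <= n)%N := leq_trans (leq_maxl _ _) mn.
  have bn := m1P n (leq_trans (leq_maxr _ _) mn).
  have bn0 := b_lt0 n.
  (* Bounds $|\varphi - F D_n|$ on $[-A, A]$: by [turan_lim_unif] where $\varphi \ne 0$, and
     trivially elsewhere, as [F] vanishes with $\varphi$. *)
  pose eta := `|F z| * (`|K| * - b n.+1).
  have cFT : continuous (fun x => F x * turan b n x) by solve_continuous.
  have := @itv_Rintegral_dist R mu (- A) A mu_fin phi _ (fun=> eta) cphi cFT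
    (@continuous_funcst R eta).
  rewrite Rintegral_cst//.
  move=> H; apply: le_trans (H _) _ => {H}.
    move=> x xA; have [p0|p0] := eqVneq (phi x) 0.
      rewrite /F p0 !mul0r subrr normr0 /eta mulr_ge0// mulr_ge0//.
      by rewrite oppr_ge0 ltW.
    have xcd := phi0 _ p0.
    rewrite -{1}(Fphi x) clamp_id// -mulrBr normrM.
    apply: ler_pM => //; first exact: zM.
    apply: le_trans (KP _ _ nm0 _) _; first by rewrite in_itv.
    by apply: ler_wpM2r; [rewrite oppr_ge0 ltW|exact: ler_norm].
  rewrite -/V; apply: (@le_trans _ _ (B * - b n.+1)).
    have -> : eta * V = (`|F z| * `|K| * V) * - b n.+1 by rewrite /eta; ring.
    by apply: ler_wpM2r; [rewrite oppr_ge0 ltW|rewrite lerDl].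
  by rewrite mulrC -ler_pdivlMr// lerNl ltW.
rewrite (cvg_unique _ lim2 lim1)//.
have cFs : continuous (fun x => F x * semicircle x) by solve_continuous.
rewrite /Rintegral fineK; last first.
  apply: integrable_fin_num; first exact: measurable_itv.
  have lebesgue_fin : (@lebesgue_measure R `[(- 2)%R, 2%R]%classic < +oo)%E.
    by rewrite lebesgue_measure_itv/=; case: ifPn => //; rewrite ltry.
  exact: (itv_continuous_integrable lebesgue_fin cFs).
rewrite integral_mkcond; apply: eq_integral => x _; rewrite patchE.
have [p0|p0] := eqVneq (phi x) 0.
  by rewrite /F p0 !mul0r; case: ifPn.
have /andP[cx xd] := phi0 _ p0.
have x12 : -2 < x < 2 by rewrite (lt_le_trans c2 cx) (le_lt_trans xd d2).
rewrite mem_setE in_itv/=; have /andP[x1 x2] := x12.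
rewrite (ltW x1) (ltW x2) /= cut_weightE// /F clamp_id ?cx//; congr EFin.
by rewrite /weight; ring.
Qed.

(** Tents are admissible test functions and increase to indicators, which settles open intervals and
    hence all Borel sets. *)
Lemma spectral_density_on : is_density_on mu `]-2, 2[ (weight b).
Proof.
split=> [x|A mA AI]; first by rewrite /= in_itv/= => x12; rewrite ltW// weight_gt0.
transitivity (\int[@lebesgue_measure R]_(x in A) (cut_weight x)%:E)%E; last first.
  apply: eq_integral => x; rewrite inE => /AI; rewrite /= in_itv/= => x12.
  by rewrite cut_weightE.
apply: (density_on_open_itvs cut_weight_measurable cut_weight_ge0 _ _ mA AI).
  by rewrite ltey_eq fin_num_measure//; exact: measurable_itv.
move=> a c a2 c2.
have lim1 := @integral_tent_cvg R mu (fun=> 1) a c (measurable_cst _) (fun=> ler01).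
have lim2 := @integral_tent_cvg R lebesgue_measure cut_weight a c
  cut_weight_measurable cut_weight_ge0.
transitivity (\int[mu]_(x in `]a, c[) 1%:E)%E.
  by rewrite integral_cst ?mul1e//; exact: measurable_itv.
have lim3 : (\int[mu]_x (tent a c k x * 1)%:E @[k --> \oo] -->
    \int[@lebesgue_measure R]_(x in `]a, c[) (cut_weight x)%:E)%E.
  apply: cvg_trans lim2; apply: near_eq_cvg; apply: nearW => k.
  have k0 : 0 < k.+1%:R^-1 :> R by rewrite invr_gt0.
  have k1 : k.+1%:R^-1 <= 1 :> R by rewrite invf_le1// ler1n.
  under [RHS]eq_integral do rewrite mulr1.
  apply/esym.
  (* The support of the tent keeps the distance $1/(k+1) \le 1$ from $\pm 2$, so these bounds are
     ordered. *)
  apply: (@integral_test_function _ (-2 + k.+1%:R^-1) (2 - k.+1%:R^-1)).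
  - exact: tent_continuous.
  - by rewrite ltrDl.
  - by move: k0 k1; move: (k.+1%:R^-1) => e *; lra.
  - by rewrite ltrBlDr ltrDl.
  - move=> x /tent_neq0; move: k0 k1; move: (k.+1%:R^-1) => e e0 e1 /andP[x1 x2].
    by apply/andP; split; lra.
exact: (cvg_unique _ lim1 lim3).
Qed.

End spectral_density.

Theorem theorem2p1 (R : realType) :
  exists C : R -> R, (forall s, 0 < C s) /\
  forall (b : nat -> R) (mu : probability (measurableTypeR R) R),
    is_spectral_measure (fun=> 1) b mu ->
    (forall n, (1 <= n)%N -> b n <= b n.+1 /\ b n.+1 < 0) ->
    b @ \oo --> (0 : R) ->
    mrestr mu (measurable_itv `]-2, 2[) `<< @lebesgue_measure R /\
    exists w : R -> R,
      [/\ is_density_on mu `]-2, 2[ w,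
          {in `]-2, 2[, continuous w} /\ (forall x, x \in `]-2, 2[ -> w x != 0),
          (exists C1 C2 : R, [/\ 0 < C1, 0 < C2 &
             forall x, -2 < x <= 0 -> C1 * (x + 2) <= w x <= C2 * (x + 2)^-1])
        & forall x, 0 < x < 2 -> (1 <= turning_point b x)%N ->
            ((`|exponent w x - g b x|)%:E <= h (C (sup_abs b)) b x)%E].
Proof.
exists (fun=> 32); split=> [s|b mu mu_spectral b_mono b_cvg0]; first exact: ltr0n.
have b_nd n : b n.+1 <= b n.+2 by case: (b_mono n.+1 isT).
(* The assumption gives negativity from $b_2$ on; $b_1$ inherits it from $b_1 \le b_2$. *)
have b_lt0 n : b n.+1 < 0.
  by apply: le_lt_trans (b_nd n) _; case: (b_mono n.+1 isT).
have density := spectral_density_on b_nd b_lt0 b_cvg0 mu_spectral.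
split.
  apply/null_content_dominatesP => A mA A0; rewrite /mrestr density.2.
  - have mAI : measurable (A `&` `]-2, 2[%classic) by apply: measurableI.
    apply: null_set_integral => //.
      apply/measurable_EFinP.
      apply: measurable_funS _ _ (weight_measurable b_nd b_lt0 b_cvg0).
        exact: measurable_itv.
      exact: subIsetr.
    by apply: subset_measure0 A0 => //; exact: subIsetl.
  - by apply: measurableI.
  - exact: subIsetr.
exists (weight b); split=> //.
- split=> x; rewrite in_itv/= => x12.
    exact: (weight_continuous b_nd b_lt0 b_cvg0 x12).
  by rewrite lt0r_neq0// weight_gt0.
- exact: weight_left_edge.
- by move=> x x02 N1; apply: exponent_bound.
Qed.
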